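(* (ZF, without the Axiom of Choice.) (1) $UD(\omega_1)$ implies that $M(\omega_1,\omega,n)\to ED$ holds for each natural number $n\in\omega$. (2) $M(\omega_1,\omega,2)\to ED$ implies $cf(\omega_1)=\omega_1$.
   Context: The base theory is ZF. A function $f$ is a uniform denumeration on $\omega_1$ iff $\mathrm{dom}(f)=\omega_1$ and $f(\alpha)$ is a function from $\omega$ onto $\alpha$ for each $1\le\alpha<\omega_1$. $UD(\omega_1)$ is the assertion that there exists a uniform denumeration on $\omega_1$. A family $\mathcal A$ of sets is $n$-almost disjoint iff $|A\cap B|<n$ for each $\{A,B\}\in[\mathcal A]^2$. A family $\mathcal A$ is essentially disjoint iff there is a function $f$ with $\mathrm{dom}(f)=\mathcal A$ and $f(A)\in[A]^{<\omega}$ for each $A\in\mathcal A$ such that $\{A\setminus f(A):A\in\mathcal A\}$ is a family of pairwise disjoint sets. $M(\kappa,\omega,n)\to ED$ is the statement that every $n$-almost disjoint family $\mathcal A\subset[\kappa]^{\omega}$ is essentially disjoint, where $[\kappa]^\omega$ is the set of countably infinite subsets of $\kappa$. *)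

(* Defs.v *)
(** The base theory ZF is rendered through its first-order models: a statement
    is a theorem of ZF iff it holds in every set structure satisfying the
    axioms of ZF (Gödel completeness).  Separation and Replacement range over
    first-order formulas with parameters, not over arbitrary predicates of the
    ambient logic: with the latter, choice principles of the metatheory would
    make the Axiom of Choice true in every model.

    All set-theoretic notions below are first-order over membership and are
    evaluated inside the model; in particular [ω], [ω_1], functions and natural
    numbers are those of the model. *)

Record set_structure : Type := SetStructure {
  carrier :> Type;
  mem : carrier -> carrier -> Prop
}.

Arguments mem {_} _ _.
Notation "x ∈ y" := (mem x y) (at level 70, no associativity).
Notation "x ∉ y" := (~ mem x y) (at level 70, no associativity).

(** First-order formulas of the language of set theory, with de Bruijn indices
    for variables. *)
Inductive formula : Type :=
| f_mem (i j : nat)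
| f_eq (i j : nat)
| f_bot
| f_imp (p q : formula)
| f_and (p q : formula)
| f_or (p q : formula)
| f_all (p : formula)
| f_ex (p : formula).

Definition scons {T : Type} (x : T) (rho : nat -> T) : nat -> T :=
  fun n => match n with O => x | S m => rho m end.

Fixpoint sat {V : set_structure} (rho : nat -> V) (phi : formula) : Prop :=
  match phi with
  | f_mem i j => rho i ∈ rho j
  | f_eq i j => rho i = rho j
  | f_bot => False
  | f_imp p q => sat rho p -> sat rho q
  | f_and p q => sat rho p /\ sat rho q
  | f_or p q => sat rho p \/ sat rho q
  | f_all p => forall x : V, sat (scons x rho) p
  | f_ex p => exists x : V, sat (scons x rho) p
  end.

Definition is_subset {V : set_structure} (a b : V) : Prop :=
  forall x : V, x ∈ a -> x ∈ b.

Definition is_empty {V : set_structure} (a : V) : Prop :=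
  forall x : V, x ∉ a.

Definition is_pair {V : set_structure} (p a b : V) : Prop :=
  forall x : V, x ∈ p <-> x = a \/ x = b.

Definition is_inter {V : set_structure} (d a b : V) : Prop :=
  forall x : V, x ∈ d <-> x ∈ a /\ x ∈ b.

Definition is_diff {V : set_structure} (d a b : V) : Prop :=
  forall x : V, x ∈ d <-> x ∈ a /\ x ∉ b.

(** [s = x ∪ {x}] *)
Definition is_succ {V : set_structure} (s x : V) : Prop :=
  forall y : V, y ∈ s <-> y ∈ x \/ y = x.

Definition is_inductive {V : set_structure} (a : V) : Prop :=
  (exists e : V, is_empty e /\ e ∈ a) /\
  (forall x : V, x ∈ a -> exists s : V, is_succ s x /\ s ∈ a).

Record ZF (V : set_structure) : Prop := {
  zf_extensionality : forall a b : V, (forall x : V, x ∈ a <-> x ∈ b) -> a = b;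
  zf_foundation : forall a : V, ~ is_empty a ->
    exists y : V, y ∈ a /\ ~ exists z : V, z ∈ y /\ z ∈ a;
  zf_pairing : forall a b : V, exists p : V, is_pair p a b;
  zf_union : forall a : V, exists u : V,
    forall x : V, x ∈ u <-> exists y : V, x ∈ y /\ y ∈ a;
  zf_powerset : forall a : V, exists p : V,
    forall x : V, x ∈ p <-> is_subset x a;
  zf_infinity : exists a : V, is_inductive a;
  zf_separation : forall (phi : formula) (rho : nat -> V) (a : V),
    exists b : V, forall x : V, x ∈ b <-> x ∈ a /\ sat (scons x rho) phi;
  (* variable 0 is the value, variable 1 the argument *)
  zf_replacement : forall (phi : formula) (rho : nat -> V) (a : V),
    (forall x y y' : V, x ∈ a ->
       sat (scons y (scons x rho)) phi ->
       sat (scons y' (scons x rho)) phi -> y = y') ->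
    exists b : V, forall y : V,
      y ∈ b <-> exists x : V, x ∈ a /\ sat (scons y (scons x rho)) phi
}.

(** Kuratowski ordered pair [p = {{a}, {a, b}}] *)
Definition is_opair {V : set_structure} (p a b : V) : Prop :=
  exists s t : V, is_pair s a a /\ is_pair t a b /\ is_pair p s t.

(** [(x, y) ∈ f]; when [f] is a function, [f(x) = y]. *)
Definition maps {V : set_structure} (f x y : V) : Prop :=
  exists p : V, is_opair p x y /\ p ∈ f.

Definition is_function {V : set_structure} (f : V) : Prop :=
  (forall p : V, p ∈ f -> exists x y : V, is_opair p x y) /\
  (forall x y y' : V, maps f x y -> maps f x y' -> y = y').

Definition has_dom {V : set_structure} (f d : V) : Prop :=
  forall x : V, x ∈ d <-> exists y : V, maps f x y.

Definition has_ran {V : set_structure} (f r : V) : Prop :=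
  forall y : V, y ∈ r <-> exists x : V, maps f x y.

Definition function_into {V : set_structure} (f a b : V) : Prop :=
  is_function f /\ has_dom f a /\ forall x y : V, maps f x y -> y ∈ b.

Definition function_onto {V : set_structure} (f a b : V) : Prop :=
  is_function f /\ has_dom f a /\ has_ran f b.

Definition is_injective {V : set_structure} (f : V) : Prop :=
  forall x x' y : V, maps f x y -> maps f x' y -> x = x'.

Definition equinumerous {V : set_structure} (a b : V) : Prop :=
  exists f : V, function_onto f a b /\ is_injective f.

Definition is_transitive {V : set_structure} (a : V) : Prop :=
  forall x : V, x ∈ a -> is_subset x a.

Definition well_ordered_by_mem {V : set_structure} (a : V) : Prop :=
  (forall x : V, x ∈ a -> x ∉ x) /\
  (forall x y z : V, x ∈ a -> y ∈ a -> z ∈ a -> x ∈ y -> y ∈ z -> x ∈ z) /\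
  (forall x y : V, x ∈ a -> y ∈ a -> x ∈ y \/ x = y \/ y ∈ x) /\
  (forall b : V, is_subset b a -> ~ is_empty b ->
     exists m : V, m ∈ b /\ forall x : V, x ∈ b -> m = x \/ m ∈ x).

Definition is_ordinal {V : set_structure} (a : V) : Prop :=
  is_transitive a /\ well_ordered_by_mem a.

Definition is_omega {V : set_structure} (w : V) : Prop :=
  is_inductive w /\ forall a : V, is_inductive a -> is_subset w a.

(** The von Neumann numeral of a standard natural number. *)
Fixpoint is_numeral {V : set_structure} (n : nat) (x : V) : Prop :=
  match n with
  | O => is_empty x
  | S m => exists y : V, is_numeral m y /\ is_succ x y
  end.

(** In the definitions below the parameter [w] stands for [ω]. *)

Definition is_countable {V : set_structure} (w a : V) : Prop :=
  exists f : V, function_into f a w /\ is_injective f.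

Definition is_finite {V : set_structure} (w a : V) : Prop :=
  exists m : V, m ∈ w /\ equinumerous a m.

(** [|a| < n] for [n ∈ ω], that is [|a| = m] for some [m < n]. *)
Definition card_lt {V : set_structure} (a n : V) : Prop :=
  exists m : V, m ∈ n /\ equinumerous a m.

(** The least uncountable ordinal. *)
Definition is_omega1 {V : set_structure} (w k : V) : Prop :=
  is_ordinal k /\ ~ is_countable w k /\
  forall a : V, a ∈ k -> is_countable w a.

(** There is a map from [d] to [k] with unbounded range; between ordinals,
    inclusion is [≤]. *)
Definition maps_cofinally {V : set_structure} (d k : V) : Prop :=
  exists g : V, function_into g d k /\
    forall a : V, a ∈ k -> exists x y : V, maps g x y /\ is_subset a y.

(** [cf(k) = d] *)
Definition has_cofinality {V : set_structure} (k d : V) : Prop :=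
  is_ordinal d /\ maps_cofinally d k /\
  forall d' : V, d' ∈ d -> ~ maps_cofinally d' k.

(** For an ordinal [a], [1 ≤ a] means that [a] is nonempty. *)
Definition uniform_denumeration {V : set_structure} (w k f : V) : Prop :=
  is_function f /\ has_dom f k /\
  forall a g : V, a ∈ k -> ~ is_empty a -> maps f a g -> function_onto g w a.

Definition UD {V : set_structure} (w k : V) : Prop :=
  exists f : V, uniform_denumeration w k f.

Definition almost_disjoint {V : set_structure} (n F : V) : Prop :=
  forall A B : V, A ∈ F -> B ∈ F -> A <> B ->
  forall d : V, is_inter d A B -> card_lt d n.

(** Pairwise disjointness of [{A \ f(A) : A ∈ F}] is that of the family indexed
    by [F]. *)
Definition essentially_disjoint {V : set_structure} (w F : V) : Prop :=
  exists f : V,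
    is_function f /\ has_dom f F /\
    (forall A s : V, maps f A s -> is_subset s A /\ is_finite w s) /\
    (forall A B s t C D : V,
       maps f A s -> maps f B t -> A <> B ->
       is_diff C A s -> is_diff D B t ->
       ~ exists x : V, x ∈ C /\ x ∈ D).

(** [M(k, ω, n) → ED] *)
Definition M_ED {V : set_structure} (w k n : V) : Prop :=
  forall F : V,
    (forall A : V, A ∈ F -> is_subset A k /\ equinumerous A w) ->
    almost_disjoint n F -> essentially_disjoint w F.

(* Main.v *)
From Stdlib Require Import Classical Arith.
Require Import Defs.

(** (1) Fix surjections [ω → α] for [1 ≤ α < ω_1]; they give uniform finite
    approximations of every [α] and make [ω_1] regular.  A finite set of at least
    [n] points lies in at most one member of the family, so the ordinals [γ] that
    contain every member meeting [γ] in at least [n] points are closed and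
    unbounded.  Let the level of [A] be the least such [γ ⊇ A].  Remove from [A]
    its finitely many points that lie in some such [γ] not containing [A], and its
    intersections with the finitely many [B] of the same level [γ] whose traces on
    the finite approximations of [γ] reach size [n] no later than those of [A].

    (2) If [α_i] is an increasing [ω]-sequence cofinal in [ω_1], the columns
    [{l + i : l < α_i}] ([i < ω]) and the blocks [{l + i : i < ω}] ([l] zero or a
    limit) form a 2-almost disjoint family.  Given finite removals [f], each block
    loses finitely many points, so each [l] occurs as [l + i ∈ f(column i)] for
    some [i].  Thus the [l]'s are covered by [ω] many finite sets of ordinals, and
    [ω_1] would be countable. *)

(** * Definable classes *)

(** Without choice nothing may be selected arbitrarily at infinitely many places. Where infinitely
    many ordinals are needed at once, the least ones with a definable property are taken; other
    selections are finite in number. Countability is derived from linear orders with finite initial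
    segments, because counting predecessors requires no chosen enumeration. A union of ω finite sets
    of ordinals carries such an order, whereas a union of ω countable sets need not be countable.
    Uniform denumerations reduce the second kind of union to the first: cutting every surjection at
    a natural number [m] presents each countable ordinal as an increasing union of finite sets. The
    same cuts compare the members of one level by natural numbers, with only finitely many members
    at each number, so these members need not be enumerated. Separation and Replacement are
    available for first-order formulas only, so every class handed to them must be shown definable;
    the closure lemmas and tactics below do this. *)

Fixpoint rename (s : nat -> nat) (phi : formula) : formula :=
  let up := fun i => match i with O => O | S j => S (s j) end in
  match phi with
  | f_mem i j => f_mem (s i) (s j)
  | f_eq i j => f_eq (s i) (s j)
  | f_bot => f_bot
  | f_imp p q => f_imp (rename s p) (rename s q)
  | f_and p q => f_and (rename s p) (rename s q)
  | f_or p q => f_or (rename s p) (rename s q)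
  | f_all p => f_all (rename up p)
  | f_ex p => f_ex (rename up p)
  end.

Lemma sat_ext (V : set_structure) (phi : formula) : forall rho rho' : nat -> V,
  (forall i, rho i = rho' i) -> (sat rho phi <-> sat rho' phi).
Proof.
  induction phi; intros rho rho' H; cbn;
    try (rewrite !H; tauto); try tauto;
    try (rewrite (IHphi1 _ _ H), (IHphi2 _ _ H); tauto).
  - split; intros A x; specialize (A x); revert A; apply IHphi;
      intros [|i]; cbn; auto.
  - split; intros [x A]; exists x; revert A; apply IHphi;
      intros [|i]; cbn; auto.
Qed.

Lemma sat_rename (V : set_structure) (phi : formula) :
  forall (s : nat -> nat) (rho : nat -> V),
  sat rho (rename s phi) <-> sat (fun i => rho (s i)) phi.
Proof.
  induction phi; intros s rho; cbn; try tauto;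
    try (rewrite IHphi1, IHphi2; tauto).
  - split; intros A x; specialize (A x); revert A; rewrite IHphi; apply sat_ext;
      intros [|i]; reflexivity.
  - split; intros [x A]; exists x; revert A; rewrite IHphi; apply sat_ext;
      intros [|i]; reflexivity.
Qed.

(** A variable of a formula is interpreted by an entry of the environment or by
    a fixed parameter. *)
Definition value {V : Type} (rho : nat -> V) (a : nat + V) : V :=
  match a with inl i => rho i | inr v => v end.

(** Stated for predicates of environments, so that each connective and quantifier of a Rocq
    statement is matched by one closure lemma. A single formula must serve all environments. *)
Definition definable {V : set_structure} (P : (nat -> V) -> Prop) : Prop :=
  exists (phi : formula) (f : nat -> nat + V),
    forall rho, P rho <-> sat (fun i => value rho (f i)) phi.

Definition is_term {V : Type} (t : (nat -> V) -> V) : Prop :=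
  exists a : nat + V, forall rho, t rho = value rho a.

Section Definable.
Context {V : set_structure}.
Implicit Types (P Q : (nat -> V) -> Prop) (t u : (nat -> V) -> V).

Lemma term_var (i : nat) : is_term (fun rho : nat -> V => rho i).
Proof. exists (inl i); reflexivity. Qed.

Lemma term_const (v : V) : is_term (fun _ : nat -> V => v).
Proof. exists (inr v); reflexivity. Qed.

(** Passing under a quantifier shifts the environment by one; [n] counts the quantifiers passed
    since the term was introduced. *)
Lemma term_shift n t : is_term t -> is_term (fun rho => t (fun i => rho (n + i))).
Proof.
  intros [[i|v] H].
  - exists (inl (n + i)); intro; exact (H _).
  - exists (inr v); intro; exact (H _).
Qed.

Lemma definable_mem t u :
  is_term t -> is_term u -> definable (fun rho => t rho ∈ u rho).
Proof.
  intros [a A] [b B].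
  exists (f_mem 0 1), (fun i => match i with O => a | _ => b end).
  intro; cbn. rewrite A, B; tauto.
Qed.

Lemma definable_eq t u :
  is_term t -> is_term u -> definable (fun rho => t rho = u rho).
Proof.
  intros [a A] [b B].
  exists (f_eq 0 1), (fun i => match i with O => a | _ => b end).
  intro; cbn. rewrite A, B; tauto.
Qed.

Lemma definable_bot : definable (fun _ : nat -> V => False).
Proof. exists f_bot, (fun i => inl i). intro; cbn; tauto. Qed.

(** Even indices carry the assignment for [P] and odd ones that for [Q], so one assignment serves
    both formulas. *)
Lemma definable_merge P Q : definable P -> definable Q ->
  exists phi psi f,
    (forall rho, P rho <-> sat (fun i => value rho (f i)) phi) /\
    (forall rho, Q rho <-> sat (fun i => value rho (f i)) psi).
Proof.
  intros (phi & f & A) (psi & g & B).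
  exists (rename (fun i => 2 * i) phi), (rename (fun i => 2 * i + 1) psi),
    (fun i => if Nat.even i then f (i / 2) else g (i / 2)).
  split; intro rho; [rewrite A|rewrite B]; rewrite sat_rename; apply sat_ext;
    intro i; f_equal.
  - rewrite Nat.even_mul. cbn [Nat.even orb].
    rewrite Nat.mul_comm, Nat.div_mul; auto.
  - rewrite Nat.even_add, Nat.even_mul. cbn [Nat.even orb Bool.eqb].
    f_equal. rewrite Nat.mul_comm, Nat.div_add_l; auto.
Qed.

Lemma definable_and P Q :
  definable P -> definable Q -> definable (fun rho => P rho /\ Q rho).
Proof.
  intros HP HQ. destruct (definable_merge P Q HP HQ) as (phi & psi & f & A & B).
  exists (f_and phi psi), f. intro; cbn. rewrite A, B; tauto.
Qed.

Lemma definable_or P Q :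
  definable P -> definable Q -> definable (fun rho => P rho \/ Q rho).
Proof.
  intros HP HQ. destruct (definable_merge P Q HP HQ) as (phi & psi & f & A & B).
  exists (f_or phi psi), f. intro; cbn. rewrite A, B; tauto.
Qed.

Lemma definable_imp P Q :
  definable P -> definable Q -> definable (fun rho => P rho -> Q rho).
Proof.
  intros HP HQ. destruct (definable_merge P Q HP HQ) as (phi & psi & f & A & B).
  exists (f_imp phi psi), f. intro; cbn. rewrite A, B; tauto.
Qed.

Lemma definable_not P : definable P -> definable (fun rho => ~ P rho).
Proof. intro. apply definable_imp; [assumption|apply definable_bot]. Qed.

Lemma definable_iff P Q :
  definable P -> definable Q -> definable (fun rho => P rho <-> Q rho).
Proof. intros. apply definable_and; apply definable_imp; assumption. Qed.

Lemma definable_bind P : definable P -> exists phi f,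
  forall rho x, P (scons x rho) <-> sat (scons x (fun i => value rho (f i))) phi.
Proof.
  intros (phi & f & A).
  (* Several indices of [phi] may stand for the variable to be bound; they are merged into index 0,
     and all others move up by one. *)
  exists (rename (fun i => match f i with inl O => O | _ => S i end) phi),
    (fun i => match f i with inl (S j) => inl j | a => a end).
  intros rho x. rewrite A, sat_rename. apply sat_ext. intro i.
  destruct (f i) as [[|j]|v] eqn:E; cbn; rewrite ?E; reflexivity.
Qed.

Lemma definable_all (P : V -> (nat -> V) -> Prop) :
  definable (fun rho => P (rho 0) (fun i => rho (S i))) ->
  definable (fun rho => forall x, P x rho).
Proof.
  intro H. destruct (definable_bind _ H) as (phi & f & A).
  exists (f_all phi), f. intro rho; cbn.
  split; intros B x; specialize (B x); apply (A rho x) in B || apply (A rho x);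
    exact B.
Qed.

Lemma definable_ex (P : V -> (nat -> V) -> Prop) :
  definable (fun rho => P (rho 0) (fun i => rho (S i))) ->
  definable (fun rho => exists x, P x rho).
Proof.
  intro H. destruct (definable_bind _ H) as (phi & f & A).
  exists (f_ex phi), f. intro rho; cbn.
  split; intros [x B]; exists x; apply (A rho x) in B || apply (A rho x);
    exact B.
Qed.

End Definable.

(** Quantifying over terms makes the property stable under substitution, so that a hypothesis of
    this form applies under any number of binders. *)
Definition class1 {V : set_structure} (P : V -> Prop) : Prop :=
  forall t, is_term t -> definable (fun rho => P (t rho)).

Definition class2 {V : set_structure} (R : V -> V -> Prop) : Prop :=
  forall t u, is_term t -> is_term u -> definable (fun rho => R (t rho) (u rho)).

Definition is_adjoin {V : set_structure} (y x a : V) : Prop :=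
  forall z : V, z ∈ y <-> z ∈ x \/ z = a.

Ltac is_shifted n H :=
  first [ exact (term_shift n _ H)
        | lazymatch n with 20 => fail | _ => is_shifted (S n) H end ].

Ltac is_term :=
  first [ apply term_var | apply term_const
        | match goal with H : is_term _ |- _ => is_shifted 0 H end ].

(* Redefined below, once the notions of set theory are known to be definable. *)
Ltac definable_notion := fail.

(** An implication also matches the [forall] pattern, so it is tried before the quantifier. *)
Ltac definable_step :=
  cbv beta;
  lazymatch goal with
  | |- is_term _ => is_term
  | |- definable (fun rho => _ ∈ _) => apply definable_mem
  | |- definable (fun rho => _ = _) => apply definable_eq
  | |- definable (fun rho => False) => apply definable_bot
  | |- definable (fun rho => _ /\ _) => apply definable_and
  | |- definable (fun rho => _ \/ _) => apply definable_or
  | |- definable (fun rho => ~ _) => apply definable_not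
  | |- definable (fun rho => _ <-> _) => apply definable_iff
  | |- definable (fun rho => exists x, _) => apply definable_ex
  | |- definable (fun rho => forall x, _) =>
      first [apply definable_imp | apply definable_all]
  | H : class2 ?R |- definable (fun rho => ?R _ _) => apply H
  | H : class1 ?P |- definable (fun rho => ?P _) => apply H
  | |- class1 _ => intros ? ?
  | |- class2 _ => intros ? ? ? ?
  | |- _ => definable_notion
  end.

Ltac definable := repeat definable_step.

Ltac unfold_notions :=
  unfold card_lt, is_finite, equinumerous, function_onto, is_injective, has_ran,
    has_dom, is_function, maps, is_opair, is_adjoin, is_succ, is_diff, is_inter,
    is_pair, is_empty, is_subset.

(** * Definability of the notions of set theory *)

Section DefinableNotions.
Context {V : set_structure}.
Implicit Types t u v : (nat -> V) -> V.

Lemma definable_is_subset t u : is_term t -> is_term u ->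
  definable (fun rho => is_subset (t rho) (u rho)).
Proof. intros; unfold_notions; definable. Qed.

Lemma definable_is_empty t : is_term t ->
  definable (fun rho => is_empty (t rho)).
Proof. intros; unfold_notions; definable. Qed.

Lemma definable_is_inter t u v : is_term t -> is_term u -> is_term v ->
  definable (fun rho => is_inter (t rho) (u rho) (v rho)).
Proof. intros; unfold_notions; definable. Qed.

Lemma definable_is_diff t u v : is_term t -> is_term u -> is_term v ->
  definable (fun rho => is_diff (t rho) (u rho) (v rho)).
Proof. intros; unfold_notions; definable. Qed.

Lemma definable_is_succ t u : is_term t -> is_term u ->
  definable (fun rho => is_succ (t rho) (u rho)).
Proof. intros; unfold_notions; definable. Qed.

Lemma definable_is_adjoin t u v : is_term t -> is_term u -> is_term v ->
  definable (fun rho => is_adjoin (t rho) (u rho) (v rho)).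
Proof. intros; unfold_notions; definable. Qed.

Lemma definable_is_opair t u v : is_term t -> is_term u -> is_term v ->
  definable (fun rho => is_opair (t rho) (u rho) (v rho)).
Proof. intros; unfold_notions; definable. Qed.

Lemma definable_maps t u v : is_term t -> is_term u -> is_term v ->
  definable (fun rho => maps (t rho) (u rho) (v rho)).
Proof. intros; unfold_notions; definable. Qed.

Lemma definable_equinumerous t u : is_term t -> is_term u ->
  definable (fun rho => equinumerous (t rho) (u rho)).
Proof. intros; unfold_notions; definable. Qed.

Lemma definable_is_finite t u : is_term t -> is_term u ->
  definable (fun rho => is_finite (t rho) (u rho)).
Proof. intros; unfold_notions; definable. Qed.

Lemma definable_card_lt t u : is_term t -> is_term u ->
  definable (fun rho => card_lt (t rho) (u rho)).
Proof. intros; unfold_notions; definable. Qed.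

End DefinableNotions.

Ltac definable_notion ::=
  lazymatch goal with
  | |- definable (fun rho => is_subset _ _) => apply definable_is_subset
  | |- definable (fun rho => is_empty _) => apply definable_is_empty
  | |- definable (fun rho => is_inter _ _ _) => apply definable_is_inter
  | |- definable (fun rho => is_diff _ _ _) => apply definable_is_diff
  | |- definable (fun rho => is_succ _ _) => apply definable_is_succ
  | |- definable (fun rho => is_adjoin _ _ _) => apply definable_is_adjoin
  | |- definable (fun rho => is_opair _ _ _) => apply definable_is_opair
  | |- definable (fun rho => maps _ _ _) => apply definable_maps
  | |- definable (fun rho => equinumerous _ _) => apply definable_equinumerous
  | |- definable (fun rho => is_finite _ _) => apply definable_is_finite
  | |- definable (fun rho => card_lt _ _) => apply definable_card_lt
  end.

(** * Elementary set theory in a model *)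

Section SetTheory.
Context {V : set_structure} (HZF : ZF V).
Implicit Types a b c d f k m n p s x y z : V.

Lemma ext a b : (forall x, x ∈ a <-> x ∈ b) -> a = b.
Proof. apply zf_extensionality, HZF. Qed.

Lemma separation (P : V -> Prop) a :
  class1 P -> exists b, forall x, x ∈ b <-> x ∈ a /\ P x.
Proof.
  intro HP. specialize (HP _ (term_var 0)).
  destruct (definable_bind _ HP) as (phi & f & A).
  (* Free variables other than 0 get the default value [a]. *)
  destruct (zf_separation V HZF phi (fun i => value (fun _ => a) (f i)) a) as [b B].
  exists b. intro x. rewrite B. specialize (A (fun _ => a) x). cbn in A. tauto.
Qed.

Lemma replacement (R : V -> V -> Prop) a : class2 R ->
  (forall x y y', x ∈ a -> R x y -> R x y' -> y = y') ->
  exists b, forall y, y ∈ b <-> exists x, x ∈ a /\ R x y.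
Proof.
  intros HR F. specialize (HR _ _ (term_var 1) (term_var 0)).
  destruct HR as (phi & f & A).
  (* Indices standing for the value or the argument are merged into 0 and 1, as the axiom expects;
     every other index moves up by two and reads its fixed value from [env]. *)
  set (psi := rename (fun i => match f i with
    inl O => O | inl (S O) => 1 | _ => S (S i) end) phi).
  set (env := fun i => value (fun _ : nat => a) (f i)).
  assert (B : forall x y, R x y <-> sat (scons y (scons x env)) psi).
  { intros x y. specialize (A (scons y (scons x (fun _ => a)))). cbn in A. rewrite A.
    unfold psi. rewrite sat_rename. apply sat_ext. intro i.
    destruct (f i) as [[|[|j]]|v] eqn:E; cbn; unfold env; rewrite ?E; reflexivity. }
  destruct (zf_replacement V HZF psi env a) as [b C].
  - intros x y y' X Y Y'. apply B in Y, Y'. eauto.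
  - exists b. intro y. rewrite C. split; intros (x & X & Y); exists x;
      (split; [exact X|apply B; exact Y]).
Qed.

(** Foundation for the part of [a] where [P] holds; transitivity keeps the elements of the minimum
    inside [a], so none of them satisfies [P]. Least ordinals obtained here take the place of
    choice. *)
Lemma mem_min a (P : V -> Prop) : class1 P -> is_transitive a ->
  (exists x, x ∈ a /\ P x) -> exists x, x ∈ a /\ P x /\ forall y, y ∈ x -> ~ P y.
Proof.
  intros HP T (x & X & Px).
  destruct (separation P a HP) as [b B].
  destruct (zf_foundation V HZF b) as (y & Y & N).
  { intro E. apply (E x), B; auto. }
  apply B in Y. exists y. repeat split; try apply Y.
  intros z Z Pz. apply N. exists z. split; auto. apply B. split; auto.
  apply (T y); tauto.
Qed.

Lemma mem_asym x y : x ∈ y -> y ∈ x -> False.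
Proof.
  intros A B. destruct (zf_pairing V HZF x y) as [p H].
  destruct (zf_foundation V HZF p) as (z & Z & N).
  { intro E. apply (E x), H; auto. }
  apply N. apply H in Z as [-> | ->]; [exists y|exists x]; split; auto; apply H; auto.
Qed.

Lemma mem_irrefl x : x ∈ x -> False.
Proof. intro A. exact (mem_asym x x A A). Qed.

Lemma empty_exists a : exists e : V, is_empty e.
Proof.
  destruct (separation (fun _ => False) a) as [e E]; [definable|].
  exists e. intros x X. apply E in X. tauto.
Qed.

Lemma empty_unique a b : is_empty a -> is_empty b -> a = b.
Proof. intros A B. apply ext. intro x. split; intro X; [destruct (A x X)|destruct (B x X)]. Qed.

Lemma adjoin_exists x a : exists y, is_adjoin y x a.
Proof.
  destruct (zf_pairing V HZF a a) as [s A].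
  destruct (zf_pairing V HZF x s) as [p B].
  destruct (zf_union V HZF p) as [u C].
  exists u. intro z. rewrite C. split.
  - intros (y & Y & Z). apply B in Z as [-> | ->]; auto. apply A in Y. tauto.
  - intros [Z | ->]; [exists x|exists s]; split; auto; try apply B; auto. apply A; auto.
Qed.

Lemma succ_exists x : exists s, is_succ s x.
Proof. exact (adjoin_exists x x). Qed.

Lemma succ_inj s x y : is_succ s x -> is_succ s y -> x = y.
Proof.
  intros A B.
  destruct (proj1 (B x)) as [X | X]; [apply A; auto| |exact X].
  destruct (proj1 (A y)) as [Y | Y]; [apply B; auto| |auto].
  destruct (mem_asym _ _ X Y).
Qed.

Lemma succ_unique s s' x : is_succ s x -> is_succ s' x -> s = s'.
Proof. intros A B. apply ext. intro y. rewrite (A y), (B y). tauto. Qed.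

Lemma remove_exists a x : exists b, forall z, z ∈ b <-> z ∈ a /\ z <> x.
Proof. apply separation. definable. Qed.

Lemma adjoin_remove a b x :
  (forall z, z ∈ b <-> z ∈ a /\ z <> x) -> x ∈ a -> is_adjoin a b x.
Proof.
  intros B X z. rewrite B. split; [|intros [? | ->]; tauto].
  intro. destruct (classic (z = x)); tauto.
Qed.

Lemma is_pair_unique p q a b : is_pair p a b -> is_pair q a b -> p = q.
Proof. intros A B. apply ext. intro x. rewrite (A x), (B x). tauto. Qed.

Lemma opair_exists a b : exists p, is_opair p a b.
Proof.
  destruct (zf_pairing V HZF a a) as [s A].
  destruct (zf_pairing V HZF a b) as [t B].
  destruct (zf_pairing V HZF s t) as [p C].
  exists p, s, t. auto.
Qed.

Lemma opair_unique p q a b : is_opair p a b -> is_opair q a b -> p = q.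
Proof.
  intros (s & t & A & B & C) (s' & t' & A' & B' & C').
  rewrite (is_pair_unique _ _ _ _ A' A) in *. rewrite (is_pair_unique _ _ _ _ B' B) in *.
  exact (is_pair_unique _ _ _ _ C C').
Qed.

Lemma opair_inj p a b a' b' : is_opair p a b -> is_opair p a' b' -> a = a' /\ b = b'.
Proof.
  intros (s & t & A & B & C) (s' & t' & A' & B' & C').
  unfold is_pair in *.
  assert (E : a = a').
  { destruct (proj1 (C' s)) as [-> | ->]; [apply C; auto| |].
    - destruct (proj1 (A a')); auto. apply A'; auto.
    - destruct (proj1 (A a')); auto. apply B'; auto. }
  subst a'. split; auto.
  assert (F : s = s') by (apply ext; intro; rewrite A, A'; tauto). subst s'.
  assert (G : t = t').
  { destruct (proj1 (C' t)) as [T | T]; [apply C; auto| |auto].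
    destruct (proj1 (C t')) as [T' | T']; [apply C'; auto| |auto]. congruence. }
  subst t'.
  destruct (proj1 (B b')) as [X | X]; [apply B'; auto| |auto].
  destruct (proj1 (B' b)) as [Y | Y]; [apply B; auto| |auto]. congruence.
Qed.

(** Replacement applied to the map sending [x] to the pair of [x] and its value. *)
Lemma function_exists (R : V -> V -> Prop) a : class2 R ->
  (forall x, x ∈ a -> exists y, R x y) ->
  (forall x y y', x ∈ a -> R x y -> R x y' -> y = y') ->
  exists f, is_function f /\ has_dom f a /\ forall x y, maps f x y <-> x ∈ a /\ R x y.
Proof.
  intros HR T U.
  destruct (replacement (fun x p => exists y, R x y /\ is_opair p x y) a) as [f F].
  - definable.
  - intros x p p' X (y & Y & P) (y' & Y' & P').
    rewrite (U x y' y X Y' Y) in P'. exact (opair_unique _ _ _ _ P P').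
  - exists f.
    assert (M : forall x y, maps f x y <-> x ∈ a /\ R x y).
    { intros x y. split.
      - intros (p & P & Q). apply F in Q as (x' & X & y' & Y & P').
        destruct (opair_inj _ _ _ _ _ P P') as [-> ->]. auto.
      - intros [X Y]. destruct (opair_exists x y) as [p P]. exists p. split; auto.
        apply F. exists x. split; eauto. }
    split; [split|split].
    + intros p P. apply F in P as (x & X & y & Y & P). eauto.
    + intros x y y' A B. apply M in A, B. apply (U x); tauto.
    + intros x. split.
      * intro X. destruct (T x X) as [y Y]. exists y. apply M. auto.
      * intros [y Y]. apply M in Y. tauto.
    + exact M.
Qed.

Lemma equinumerous_intro (R : V -> V -> Prop) a b : class2 R ->
  (forall x, x ∈ a -> exists y, R x y) ->
  (forall x y y', x ∈ a -> R x y -> R x y' -> y = y') ->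
  (forall x x' y, x ∈ a -> x' ∈ a -> R x y -> R x' y -> x = x') ->
  (forall x y, x ∈ a -> R x y -> y ∈ b) ->
  (forall y, y ∈ b -> exists x, x ∈ a /\ R x y) ->
  equinumerous a b.
Proof.
  intros HR T U I B O. destruct (function_exists R a HR T U) as (f & F & D & M).
  exists f. repeat split; try apply F; try apply D.
  - intro Y. destruct (O _ Y) as (x & X & Z). exists x. apply M; auto.
  - intros [x X]. apply M in X. apply (B x); tauto.
  - intros x x' y X Y. apply M in X, Y. apply (I x x' y); tauto.
Qed.

Lemma equinumerous_elim a b : equinumerous a b -> exists f,
  (forall x y, maps f x y -> x ∈ a /\ y ∈ b) /\
  (forall x, x ∈ a -> exists y, maps f x y) /\
  (forall x y y', maps f x y -> maps f x y' -> y = y') /\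
  (forall x x' y, maps f x y -> maps f x' y -> x = x') /\
  (forall y, y ∈ b -> exists x, maps f x y).
Proof.
  intros (f & (F & D & R) & I). exists f. repeat split.
  - apply D. eauto.
  - apply R. eauto.
  - apply D.
  - apply F.
  - exact I.
  - apply R.
Qed.

Lemma equinumerous_refl a : equinumerous a a.
Proof.
  apply (equinumerous_intro (fun x y => x = y)); [definable|..]; eauto; congruence.
Qed.

Lemma equinumerous_sym a b : equinumerous a b -> equinumerous b a.
Proof.
  intro H. destruct (equinumerous_elim _ _ H) as (f & D & T & F & I & O).
  apply (equinumerous_intro (fun x y => maps f y x)); [definable|..]; eauto.
  - intros x y X M. apply (D _ _ M).
  - intros y Y. destruct (T y Y) as [x M]. exists x. split; auto. apply (D _ _ M).
Qed.

Lemma equinumerous_trans a b c :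
  equinumerous a b -> equinumerous b c -> equinumerous a c.
Proof.
  intros H H'. destruct (equinumerous_elim _ _ H) as (f & D & T & F & I & O).
  destruct (equinumerous_elim _ _ H') as (g & D' & T' & F' & I' & O').
  apply (equinumerous_intro (fun x z => exists y, maps f x y /\ maps g y z));
    [definable|..].
  - intros x X. destruct (T x X) as [y Y]. destruct (T' y) as [z Z]; [apply (D _ _ Y)|].
    eauto.
  - intros x z z' X (y & Y & Z) (y' & Y' & Z').
    rewrite (F _ _ _ Y' Y) in Z'. eauto.
  - intros x x' z X X' (y & Y & Z) (y' & Y' & Z').
    rewrite (I' _ _ _ Z' Z) in Y'. eauto.
  - intros x z X (y & Y & Z). apply (D' _ _ Z).
  - intros z Z. destruct (O' z Z) as [y Y]. destruct (O y) as [x X]; [apply (D' _ _ Y)|].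
    exists x. split; eauto. apply (D _ _ X).
Qed.

Lemma equinumerous_empty a b : is_empty a -> equinumerous a b -> is_empty b.
Proof.
  intros E H y Y. destruct (equinumerous_elim _ _ H) as (f & D & T & F & I & O).
  destruct (O y Y) as [x X]. apply (E x), (D _ _ X).
Qed.

Lemma equinumerous_of_empty a b : is_empty a -> is_empty b -> equinumerous a b.
Proof. intros A B. rewrite (empty_unique a b A B). apply equinumerous_refl. Qed.

(** If the bijection sends [x] to [j] rather than to [k], redirect the
    preimage of [k] to [j]. *)
Lemma equinumerous_remove a a' x s k : is_adjoin a a' x -> x ∉ a' -> is_succ s k ->
  equinumerous a s -> equinumerous a' k.
Proof.
  intros A X S H. destruct (equinumerous_elim _ _ H) as (f & D & T & F & I & O).
  assert (Xa : x ∈ a) by (apply A; auto).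
  assert (Ka : forall y, y ∈ a' -> y ∈ a) by (intros; apply A; auto).
  assert (Kk : k ∈ s) by (apply S; auto).
  assert (N : forall y, y ∈ a' -> y <> x) by congruence.
  assert (Nk : forall i, i ∈ k -> i <> k) by (intros i Hi ->; exact (mem_irrefl _ Hi)).
  assert (Sk : forall i, i ∈ s -> i <> k -> i ∈ k) by (intros i Hi; apply S in Hi; tauto).
  assert (Ks : forall i, i ∈ k -> i ∈ s) by (intros; apply S; auto).
  apply (equinumerous_intro (fun y i => maps f y i /\ i <> k \/ maps f y k /\ maps f x i));
    [definable|..].
  - intros y Y. destruct (T y (Ka _ Y)) as [i M].
    destruct (classic (i = k)) as [-> | E]; eauto. destruct (T x Xa) as [j J]. eauto.
  - intros y i i' Y [[M E] | [M M1]] [[M' E'] | [M' M1']]; eauto.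
    + destruct E. eauto.
    + destruct E'. eauto.
  - intros y y' i Y Y' [[M E] | [M M1]] [[M' E'] | [M' M1']]; eauto.
    + destruct (N y); eauto.
    + destruct (N y'); eauto.
  - intros y i Y [[M E] | [M M1]]; [apply Sk; auto; apply (D _ _ M)|].
    apply Sk; [apply (D _ _ M1)|]. intros ->. destruct (N y); eauto.
  - intros i Hi. destruct (O i (Ks _ Hi)) as [y M].
    destruct (classic (y = x)) as [-> | E].
    + destruct (O k Kk) as [z M']. exists z. split; auto.
      destruct (proj1 (A z)) as [Z | ->]; [apply (D _ _ M')|auto|].
      destruct (Nk i Hi). eauto.
    + exists y. split; [|left; auto]. destruct (proj1 (A y)); [apply (D _ _ M)|auto|tauto].
Qed.

Lemma equinumerous_adjoin a a' x s k : is_adjoin a a' x -> x ∉ a' -> is_succ s k ->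
  equinumerous a' k -> equinumerous a s.
Proof.
  intros A X S H. destruct (equinumerous_elim _ _ H) as (f & D & T & F & I & O).
  assert (Nx : forall i, maps f x i -> False) by (intros i M; apply X, (D _ _ M)).
  assert (Nk : forall i, maps f i k -> False)
    by (intros i M; exact (mem_irrefl k (proj2 (D _ _ M)))).
  apply (equinumerous_intro (fun y i => maps f y i \/ y = x /\ i = k)); [definable|..].
  - intros y Y. apply A in Y as [Y | ->]; eauto. destruct (T y Y); eauto.
  - intros y i i' Y [M | [-> ->]] [M' | [E E']]; subst; eauto; exfalso; eauto.
  - intros y y' i Y Y' [M | [-> ->]] [M' | [E E']]; subst; eauto; exfalso; eauto.
  - intros y i Y [M | [-> ->]]; apply S; auto. left. apply (D _ _ M).
  - intros i Hi. apply S in Hi as [Hi | ->].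
    + destruct (O i Hi) as [y M]. exists y. split; auto. apply A. left. apply (D _ _ M).
    + exists x. split; auto. apply A; auto.
Qed.

(** * Natural numbers and finite sets *)

Context (w : V) (Hw : is_omega w).

Lemma omega_empty e : is_empty e -> e ∈ w.
Proof.
  intro E. destruct Hw as [[(e' & E' & M) _] _]. rewrite (empty_unique e e'); auto.
Qed.

Lemma omega_succ s x : x ∈ w -> is_succ s x -> s ∈ w.
Proof.
  intros X S. destruct Hw as [[_ H] _]. destruct (H x X) as (s' & S' & M).
  rewrite (succ_unique s s' x); auto.
Qed.

Lemma omega_ind (P : V -> Prop) : class1 P ->
  (forall e, is_empty e -> P e) ->
  (forall x s, x ∈ w -> P x -> is_succ s x -> P s) ->
  forall x, x ∈ w -> P x.
Proof.
  intros HP Z S x X. destruct (separation P w HP) as [b B].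
  apply B. apply (proj2 Hw b); auto. split.
  - destruct (empty_exists w) as [e E]. exists e. split; auto. apply B.
    split; auto. apply omega_empty; auto.
  - intros y Y. apply B in Y as [Y Py]. destruct (succ_exists y) as [s Hs].
    exists s. split; auto. apply B. split; eauto using omega_succ.
Qed.

Lemma omega_cases x : x ∈ w -> is_empty x \/ exists y, y ∈ w /\ is_succ x y.
Proof.
  apply (omega_ind (fun x => is_empty x \/ exists y, y ∈ w /\ is_succ x y)); [definable|auto|].
  intros; right; eauto.
Qed.

Lemma omega_transitive : is_transitive w.
Proof.
  intro x. apply (omega_ind (fun x => is_subset x w)); [definable|..].
  - intros e E y Y. destruct (E y Y).
  - intros y s Y I S z Z. apply S in Z as [Z | ->]; auto.
Qed.

Lemma nat_transitive m : m ∈ w -> is_transitive m.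
Proof.
  unfold is_transitive. revert m.
  apply (omega_ind (fun m => forall x, x ∈ m -> is_subset x m)); [definable|..].
  - intros e E y Y. destruct (E y Y).
  - intros y s Y I S z Z t T. apply S. left. apply S in Z as [Z | ->]; auto.
    apply (I z); auto.
Qed.

Lemma nat_trans k m n : n ∈ w -> k ∈ m -> m ∈ n -> k ∈ n.
Proof. intros N K M. exact (nat_transitive n N m M k K). Qed.

Lemma nat_empty_le m e : m ∈ w -> is_empty e -> e ∈ m \/ e = m.
Proof.
  intros M E. revert m M.
  apply (omega_ind (fun m => e ∈ m \/ e = m)); [definable|..].
  - intros e' E'. right. apply empty_unique; auto.
  - intros x s X I S. left. apply S. tauto.
Qed.

Lemma succ_le k m s : m ∈ w -> k ∈ m -> is_succ s k -> s ∈ m \/ s = m.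
Proof.
  intros M. revert m M k s.
  apply (omega_ind (fun m => forall k s, k ∈ m -> is_succ s k -> s ∈ m \/ s = m));
    [definable|..].
  - intros e E k s K. destruct (E k K).
  - intros m t M I T k s K S. apply T in K as [K | ->].
    + left. apply T. eauto.
    + right. eapply succ_unique; eauto.
Qed.

Lemma nat_trichotomy k m : k ∈ w -> m ∈ w -> k ∈ m \/ k = m \/ m ∈ k.
Proof.
  intros K M. revert k K.
  apply (omega_ind (fun k => k ∈ m \/ k = m \/ m ∈ k)); [definable|..].
  - intros e E. destruct (nat_empty_le m e M E); auto.
  - intros k s K I S. destruct I as [I | [-> | I]].
    + destruct (succ_le k m s M I S); auto.
    + right. right. apply S; auto.
    + right. right. apply S; auto.
Qed.

Notation finite := (is_finite w).

Lemma nat_finite m : m ∈ w -> finite m.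
Proof. intro M. exists m. split; auto. apply equinumerous_refl. Qed.

Lemma finite_empty x : is_empty x -> finite x.
Proof. intro E. apply nat_finite, omega_empty, E. Qed.

Lemma finite_adjoin y x a : finite x -> is_adjoin y x a -> finite y.
Proof.
  intros (m & M & F) A. destruct (classic (a ∈ x)) as [H | H].
  - replace y with x; [exists m; auto|]. apply ext. intro z. rewrite (A z).
    split; [auto|intros [Z | ->]; auto].
  - destruct (succ_exists m) as [s S]. exists s. split; [eapply omega_succ; eauto|].
    eapply equinumerous_adjoin; eauto.
Qed.

(** Induction on the number of elements; the element taken out is the one matched with the last
    number [m] below [s]. *)
Lemma finite_ind (P : V -> Prop) : class1 P ->
  (forall e, is_empty e -> P e) ->
  (forall x y a, finite x -> P x -> a ∉ x -> is_adjoin y x a -> P y) ->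
  forall x, finite x -> P x.
Proof.
  intros HP Z S x (m & M & F). revert m M x F.
  apply (omega_ind (fun m => forall x, equinumerous x m -> P x)); [definable|..].
  - intros e E x F. apply Z. exact (equinumerous_empty _ _ E (equinumerous_sym _ _ F)).
  - intros m s M I T x F.
    destruct (equinumerous_elim _ _ F) as (f & D & _ & _ & _ & O).
    destruct (O m) as [a A]; [apply T; auto|]. apply D in A as [A _].
    destruct (remove_exists x a) as [b B].
    pose proof (adjoin_remove x b a B A) as Hb.
    assert (N : a ∉ b) by (rewrite B; tauto).
    pose proof (equinumerous_remove _ _ _ _ _ Hb N T F) as G.
    eapply S; eauto. exists m; auto.
Qed.

Lemma finite_subset x y : finite x -> is_subset y x -> finite y.
Proof.
  intro F. revert x F y.
  apply (finite_ind (fun x => forall y, is_subset y x -> finite y)); [definable|..].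
  - intros e E y Y. apply finite_empty. intros z Z. exact (E z (Y z Z)).
  - intros x x' a F I N A y Y.
    destruct (remove_exists y a) as [b B].
    assert (Fb : finite b).
    { apply I. intros z Z. apply B in Z as [Z E]. apply Y, A in Z. tauto. }
    destruct (classic (a ∈ y)) as [H | H].
    + apply (finite_adjoin y b a); auto. apply adjoin_remove; auto.
    + replace y with b; auto. apply ext. intro z. rewrite B. split; [tauto|].
      intro Z. split; congruence.
Qed.

Lemma finite_cup a b : finite a -> finite b ->
  exists c, finite c /\ is_subset a c /\ is_subset b c.
Proof.
  intros A B. revert b B.
  apply (finite_ind (fun b => exists c, finite c /\ is_subset a c /\ is_subset b c));
    [definable|..].
  - intros e E. exists a. repeat split; auto. + intros x X; auto.
    + intros x X. destruct (E x X).
  - intros x y t F (c & C & S1 & S2) N Y.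
    destruct (adjoin_exists c t) as [d D]. exists d. split; [|split].
    + eapply finite_adjoin; eauto.
    + intros z Z. apply D; auto.
    + intros z Z. apply D. apply Y in Z as [Z | ->]; auto.
Qed.

(** The bounding sets are only known to exist; the induction picks one at a time, so finitely many
    picks suffice. *)
Lemma finite_union (D : V -> V -> Prop) I : class2 D -> finite I ->
  (forall i, i ∈ I -> exists Y, finite Y /\ forall x, D i x -> x ∈ Y) ->
  exists Y, finite Y /\ forall i x, i ∈ I -> D i x -> x ∈ Y.
Proof.
  intros HD F. revert I F.
  apply (finite_ind (fun I =>
    (forall i, i ∈ I -> exists Y, finite Y /\ forall x, D i x -> x ∈ Y) ->
    exists Y, finite Y /\ forall i x, i ∈ I -> D i x -> x ∈ Y)); [definable|..].
  - intros e E _. exists e. split; [apply finite_empty; auto|].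
    intros i x X. destruct (E i X).
  - intros I J a F IH N A H. destruct IH as (Y & FY & HY).
    { intros i X. apply H, A; auto. }
    destruct (H a) as (Z & FZ & HZ); [apply A; auto|].
    destruct (finite_cup Y Z FY FZ) as (c & C & S1 & S2).
    exists c. split; auto. intros i x X Dx. apply A in X as [X | ->].
    + apply S1. eauto.
    + apply S2. eauto.
Qed.

Lemma finite_image (D : V -> V -> Prop) I X : class2 D -> finite I ->
  (forall i x x', i ∈ I -> D i x -> D i x' -> x = x') ->
  (forall x, x ∈ X -> exists i, i ∈ I /\ D i x) -> finite X.
Proof.
  intros HD F U H. destruct (finite_union D I HD F) as (Y & FY & HY).
  - intros i Hi. destruct (empty_exists I) as [e E].
    destruct (classic (exists x, D i x)) as [[x Hx] | N].
    + destruct (adjoin_exists e x) as [s S]. exists s. split.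
      * apply (finite_adjoin s e x); auto. apply finite_empty; auto.
      * intros y Y. apply S. right. eauto.
    + exists e. split; [apply finite_empty; auto|]. intros x Hx. destruct N; eauto.
  - apply (finite_subset Y); auto. intros x Hx. destruct (H x Hx) as (i & Hi & Di). eauto.
Qed.

Lemma equinumerous_finite a b : finite a -> equinumerous a b -> finite b.
Proof.
  intros (m & M & F) E. exists m. split; auto.
  apply (equinumerous_trans b a); auto. apply equinumerous_sym; auto.
Qed.

(** Points are absorbed one at a time, each time passing to an index above two given ones. Different
    choices of [B] give common bounds in ω_1, greatest elements of finite linear orders, and stages
    containing a given finite set. *)
Lemma finite_directed (B : V -> V -> Prop) I t : class2 B -> finite t ->
  (exists i, i ∈ I) ->
  (forall i j, i ∈ I -> j ∈ I -> exists k, k ∈ I /\ forall x, B x i \/ B x j -> B x k) ->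
  (forall x, x ∈ t -> exists i, i ∈ I /\ B x i) ->
  exists i, i ∈ I /\ forall x, x ∈ t -> B x i.
Proof.
  intros HB F NE Dir. revert t F.
  apply (finite_ind (fun t => (forall x, x ∈ t -> exists i, i ∈ I /\ B x i) ->
    exists i, i ∈ I /\ forall x, x ∈ t -> B x i)); [definable|..].
  - intros e E _. destruct NE as [i Hi]. exists i. split; auto. intros x X. destruct (E x X).
  - intros x y a F IH N A H. destruct IH as (i & Hi & Bi).
    { intros z Z. apply H, A; auto. }
    destruct (H a) as (j & Hj & Bj); [apply A; auto|].
    destruct (Dir i j Hi Hj) as (k & Hk & Bk). exists k. split; auto.
    intros z Z. apply Bk. apply A in Z as [Z | ->]; auto.
Qed.

(** The members of [p] avoiding the new point [a] are subsets of the smaller set; those containing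
    [a] arise from such subsets by adjoining [a]. *)
Lemma powerset_finite x p : finite x -> (forall y, y ∈ p -> is_subset y x) -> finite p.
Proof.
  intros F. revert x F p.
  apply (finite_ind (fun x => forall p, (forall y, y ∈ p -> is_subset y x) -> finite p));
    [definable|..].
  - intros e E p H. destruct (adjoin_exists e e) as [s S].
    apply (finite_subset s).
    + apply (finite_adjoin s e e); auto. apply finite_empty; auto.
    + intros y Y. apply S. right. apply empty_unique; auto.
      intros z Z. exact (E z (H y Y z Z)).
  - intros x x' a F IH N A p H.
    destruct (zf_powerset V HZF x) as [q Q].
    assert (Fq : finite q) by (apply IH; intros; apply Q; auto).
    destruct (separation (fun y => a ∈ y) p) as [p1 P1]; [definable|].
    destruct (separation (fun y => a ∉ y) p) as [p2 P2]; [definable|].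
    assert (F2 : finite p2).
    { apply (finite_subset q); auto. intros y Y. apply P2 in Y as [Y M]. apply Q.
      intros z Z. destruct (proj1 (A z) (H y Y z Z)) as [? | ->]; tauto. }
    assert (F1 : finite p1).
    { apply (finite_image (fun y z => is_adjoin z y a) q); auto; [definable|..].
      - intros y z z' _ Z Z'. apply ext. intro u. rewrite (Z u), (Z' u). tauto.
      - intros y Y. apply P1 in Y as [Y M]. destruct (remove_exists y a) as [b B].
        exists b. split.
        + apply Q. intros z Z. apply B in Z as [Z E]. apply (H y Y) in Z.
          apply A in Z. tauto.
        + apply adjoin_remove; auto. }
    destruct (finite_cup p1 p2 F1 F2) as (c & C & S1 & S2).
    apply (finite_subset c); auto. intros y Y. destruct (classic (a ∈ y)).
    + apply S1, P1; auto.
    + apply S2, P2; auto.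
Qed.

(** * Comparison of finite cardinalities *)

Lemma nat_card_unique x m k : m ∈ w -> k ∈ w ->
  equinumerous x m -> equinumerous x k -> m = k.
Proof.
  intros M K Em Ek.
  assert (G : equinumerous m k)
    by exact (equinumerous_trans _ _ _ (equinumerous_sym _ _ Em) Ek).
  clear Em Ek x. revert m M k K G.
  apply (omega_ind (fun m => forall k, k ∈ w -> equinumerous m k -> m = k)); [definable|..].
  - intros e E k K G. apply empty_unique; auto. eapply equinumerous_empty; eauto.
  - intros m s M IH S k K G. destruct (omega_cases k K) as [E | (k' & K' & S')].
    + pose proof (equinumerous_empty _ _ E (equinumerous_sym _ _ G)) as Z.
      destruct (Z m). apply S; auto.
    + rewrite (IH k' K') in S; [eapply succ_unique; eauto|].
      eapply (equinumerous_remove s m m); eauto. intro X. exact (mem_irrefl _ X).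
Qed.

Lemma nat_le_succ k m s t : m ∈ w -> k ∈ m \/ k = m -> is_succ s k -> is_succ t m ->
  s ∈ t \/ s = t.
Proof.
  intros M [H | ->] S T.
  - left. apply T. apply (succ_le k m s); auto.
  - right. eapply succ_unique; eauto.
Qed.

Lemma card_subset x y m : m ∈ w -> equinumerous x m -> is_subset y x ->
  exists k, k ∈ w /\ equinumerous y k /\ (k ∈ m \/ k = m).
Proof.
  intros M. revert m M x y.
  apply (omega_ind (fun m => forall x y, equinumerous x m -> is_subset y x ->
    exists k, k ∈ w /\ equinumerous y k /\ (k ∈ m \/ k = m))); [definable|..].
  - intros e E x y G Y. exists e. split; [apply omega_empty; auto|]. split; auto.
    apply equinumerous_of_empty; auto. intros z Z.
    exact (equinumerous_empty _ _ E (equinumerous_sym _ _ G) z (Y z Z)).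
  - intros m s M IH S x y G Y.
    destruct (equinumerous_elim _ _ G) as (f & D & _ & _ & _ & O).
    destruct (O m) as [a A]; [apply S; auto|]. apply D in A as [A _].
    destruct (remove_exists x a) as [b B].
    pose proof (adjoin_remove x b a B A) as Hb.
    assert (N : a ∉ b) by (rewrite B; tauto).
    pose proof (equinumerous_remove _ _ _ _ _ Hb N S G) as G'.
    destruct (remove_exists y a) as [c C].
    destruct (IH b c G') as (k & K & Gk & L).
    { intros z Z. apply B. apply C in Z as [Z E]. split; auto. }
    destruct (classic (a ∈ y)) as [H | H].
    + destruct (succ_exists k) as [t T]. exists t. split; [eapply omega_succ; eauto|].
      split.
      * apply (equinumerous_adjoin y c a t k); auto; [|rewrite C; tauto].
        apply adjoin_remove; auto.
      * exact (nat_le_succ k m t s M L T S).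
    + exists k. split; auto. split.
      * replace y with c; auto. apply ext. intro z. rewrite C. split; [tauto|].
        split; congruence.
      * left. apply S. auto.
Qed.

(** Taking [a] out of [x] lowers the cardinality by one and still leaves a superset of [y]. *)
Lemma card_proper_subset x y a m k : m ∈ w -> k ∈ w ->
  equinumerous x m -> equinumerous y k -> is_subset y x -> a ∈ x -> a ∉ y -> k ∈ m.
Proof.
  intros M K Gx Gy Y A N.
  destruct (omega_cases m M) as [E | (m' & M' & S)].
  { destruct (equinumerous_empty _ _ E (equinumerous_sym _ _ Gx) a A). }
  destruct (remove_exists x a) as [b B].
  pose proof (adjoin_remove x b a B A) as Hb.
  assert (Nb : a ∉ b) by (rewrite B; tauto).
  pose proof (equinumerous_remove _ _ _ _ _ Hb Nb S Gx) as G'.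
  destruct (card_subset b y m' M' G') as (k' & K' & Gk & L).
  { intros z Z. apply B. split; auto. congruence. }
  rewrite (nat_card_unique y k k') by auto. apply S. exact L.
Qed.

Lemma card_lt_subset x y n : n ∈ w -> card_lt x n -> is_subset y x -> card_lt y n.
Proof.
  intros N (m & M & G) Y.
  destruct (card_subset x y m (omega_transitive _ N _ M) G Y) as (k & K & Gk & [L | ->]).
  - exists k. split; auto. eapply nat_trans; eauto.
  - exists m; auto.
Qed.

Lemma card_lt_finite x n : n ∈ w -> card_lt x n -> finite x.
Proof. intros N (m & M & G). exists m. split; auto. eapply omega_transitive; eauto. Qed.

Lemma card_ge n : n ∈ w -> forall x, ~ card_lt x n ->
  exists s, is_subset s x /\ equinumerous s n.
Proof.
  revert n. apply (omega_ind (fun n => forall x, ~ card_lt x n ->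
    exists s, is_subset s x /\ equinumerous s n)); [definable|..].
  - intros e E x _. exists e. split; [|apply equinumerous_refl].
    intros z Z. destruct (E z Z).
  - intros n t N IH T x H.
    destruct (IH x) as (s & S & G).
    { intros (m & M & G). apply H. exists m. split; auto. apply T; auto. }
    destruct (classic (exists a, a ∈ x /\ a ∉ s)) as [(a & A & Na) | NE].
    + destruct (adjoin_exists s a) as [u U]. exists u. split.
      * intros z Z. apply U in Z as [Z | ->]; auto.
      * eapply equinumerous_adjoin; eauto.
    + destruct H. exists n. split; [apply T; auto|].
      replace x with s; auto. apply ext. intro z. split; [apply S|].
      intro Z. apply NNPP. intro Q. apply NE. eauto.
Qed.

(** Compactness of having at least [n] points: [n] of them already witness it, and finitely many
    points are all present at one index. This moves largeness from a directed union down to a single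
    stage. *)
Lemma card_ge_directed (B : V -> V -> Prop) I X n : class2 B -> n ∈ w ->
  (exists i, i ∈ I) ->
  (forall i j, i ∈ I -> j ∈ I -> exists k, k ∈ I /\ forall x, B x i \/ B x j -> B x k) ->
  (forall x, x ∈ X -> exists i, i ∈ I /\ B x i) -> ~ card_lt X n ->
  exists i, i ∈ I /\ forall d, (forall x, x ∈ d <-> x ∈ X /\ B x i) -> ~ card_lt d n.
Proof.
  intros HB N NE Dir H L. destruct (card_ge n N X L) as (s & S & G).
  destruct (finite_directed B I s) as (i & Hi & Bi); auto.
  - exists n; auto.
  - exists i. split; auto. intros d D Q.
    destruct (card_lt_subset d s n N Q) as (m & M & Gm).
    { intros x X0. apply D. auto. }
    assert (m ∈ w) by (eapply omega_transitive; eauto).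
    rewrite (nat_card_unique s m n) in M by auto. exact (mem_irrefl _ M).
Qed.

(** If ω had [m] elements, its subset [m + 1] would have at most [m]. *)
Lemma omega_infinite : ~ finite w.
Proof.
  intros (m & M & G).
  destruct (succ_exists m) as [s S].
  assert (Hs : s ∈ w) by (eapply omega_succ; eauto).
  destruct (card_subset w s m M G) as (k & K & Gk & L).
  { apply omega_transitive, Hs. }
  rewrite (nat_card_unique s k s) in L; auto using equinumerous_refl.
  assert (M' : m ∈ s) by (apply S; auto).
  destruct L as [L | L]; [exact (mem_asym _ _ L M')|].
  rewrite L in M'. exact (mem_irrefl _ M').
Qed.
(** * Countable sets and the first uncountable ordinal *)

(** A point is sent to the number of its predecessors. This injection into ω is definable from the
    order, so nothing has to be chosen, and on an infinite [X] it leaves no gap. *)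
Lemma order_countable (LT : V -> V -> Prop) X : class2 LT ->
  (forall x, x ∈ X -> ~ LT x x) ->
  (forall x y z, x ∈ X -> y ∈ X -> z ∈ X -> LT x y -> LT y z -> LT x z) ->
  (forall x y, x ∈ X -> y ∈ X -> LT x y \/ x = y \/ LT y x) ->
  (forall y, y ∈ X -> exists p, finite p /\ forall x, x ∈ X -> LT x y -> x ∈ p) ->
  is_countable w X /\ (~ finite X -> equinumerous X w).
Proof.
  intros HLT Irr Tr Tot Pre.
  set (R := fun x k => k ∈ w /\ exists p,
    (forall z, z ∈ p <-> z ∈ X /\ LT z x) /\ equinumerous p k).
  assert (HR : class2 R) by (unfold R; definable).
  assert (Seg : forall x, x ∈ X -> exists p, finite p /\ forall z, z ∈ p <-> z ∈ X /\ LT z x).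
  { intros x Hx. destruct (separation (fun z => LT z x) X) as [p P]; [definable|].
    exists p. split; auto. destruct (Pre x Hx) as (q & Fq & Q).
    apply (finite_subset q); auto. intros z Z. apply P in Z as [Z L]. auto. }
  assert (T : forall x, x ∈ X -> exists k, R x k).
  { intros x Hx. destruct (Seg x Hx) as (p & (k & K & G) & P).
    exists k. split; auto. exists p. auto. }
  assert (U : forall x k k', x ∈ X -> R x k -> R x k' -> k = k').
  { intros x k k' Hx (K & p & P & G) (K' & p' & P' & G').
    replace p' with p in G'; [eapply nat_card_unique; eauto|].
    apply ext. intro z. rewrite P, P'. tauto. }
  assert (L : forall x x' k, x ∈ X -> x' ∈ X -> R x k -> R x' k -> ~ LT x x').
  { intros x x' k Hx Hx' (K & p & P & G) (K' & p' & P' & G') L.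
    apply (mem_irrefl k). apply (card_proper_subset p' p x); auto.
    - intros z Z. apply P'. apply P in Z as [Z L']. eauto.
    - apply P'. auto.
    - rewrite P. intros [_ Q]. exact (Irr x Hx Q). }
  assert (I : forall x x' k, x ∈ X -> x' ∈ X -> R x k -> R x' k -> x = x').
  { intros x x' k Hx Hx' H H'.
    destruct (Tot x x' Hx Hx') as [Q | [Q | Q]]; auto;
      [destruct (L x x' k)|destruct (L x' x k)]; auto. }
  split.
  - destruct (function_exists R X HR T U) as (f & F & D & M).
    exists f. split; [split; [auto|split; [auto|]]|].
    + intros x y H. apply M in H. apply H.
    + intros x x' y H H'. apply M in H, H'. apply (I x x' y); tauto.
  - intro Inf.
    apply (equinumerous_intro R); auto; [intros x k _ H; apply H|].
    intros k K. apply NNPP. intro N. apply Inf.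
    (* A missing rank [k] makes all larger ranks missing: a point of rank [j + 1] has a greatest
       predecessor, which has rank [j]. Hence all ranks lie below [k], and [X] is finite. *)
    assert (A : forall j, j ∈ w -> k ∈ j \/ k = j -> forall x, x ∈ X -> ~ R x j).
    { apply (omega_ind (fun j => k ∈ j \/ k = j -> forall x, x ∈ X -> ~ R x j)).
      - unfold R; definable.
      - intros e E [H | ->]; [destruct (E k H)|]. eauto.
      - intros j s J IH S [H | ->]; [|eauto].
        intros x Hx (_ & p & P & G).
        (* This yields the greatest predecessor [z]. The guard [u ∈ p] makes the relation vacuous
           outside [X], where [LT] is not known to be transitive. *)
        destruct (finite_directed (fun u v => u ∈ p -> LT u v \/ u = v) p p) as (z & Z & M);
          [definable|..].
        + exists s. split; auto. eapply omega_succ; eauto.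
        + destruct (equinumerous_elim _ _ G) as (f & D & _ & _ & _ & O).
          destruct (O j) as [i Hi]; [apply S; auto|]. exists i. apply (D _ _ Hi).
        + assert (W : forall u v, u ∈ p -> v ∈ p -> LT u v -> forall t,
            (t ∈ p -> LT t u \/ t = u) \/ (t ∈ p -> LT t v \/ t = v) ->
            t ∈ p -> LT t v \/ t = v).
          { intros u v Hu Hv Huv t [B | B] Ht; specialize (B Ht); auto.
            apply P in Hu, Hv, Ht. left. destruct B as [B | ->]; auto.
            apply (Tr t u v); tauto. }
          intros u v Hu Hv. pose proof (proj1 (P u) Hu). pose proof (proj1 (P v) Hv).
          destruct (Tot u v) as [C | [-> | C]]; [tauto|tauto|..].
          * exists v. split; eauto.
          * exists v. split; auto. tauto.
          * exists u. split; auto. intros t B. apply (W v u Hv Hu C t). tauto.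
        + eauto.
        + pose proof (proj1 (P z) Z) as [Zx Zlt]. destruct (Seg z Zx) as (q & Fq & Q).
          apply (IH (proj1 (S k) H) z Zx). split; auto. exists q. split; auto.
          apply (equinumerous_remove p q z s j); auto.
          * intro y. rewrite Q, P. split.
            -- intros [Y Ly]. assert (Yp : y ∈ p) by (apply P; auto). destruct (M y Yp Yp); auto.
            -- intros [[Y Ly] | ->]; auto. split; auto. apply (Tr y z x); auto.
          * rewrite Q. intros [_ C]. exact (Irr z Zx C). }
    apply (finite_image (fun i x => x ∈ X /\ R x i) k); [unfold R; definable|..].
    + apply nat_finite, K.
    + intros i x x' _ [Hx H] [Hx' H']. exact (I x x' i Hx Hx' H H').
    + intros x Hx. destruct (T x Hx) as [j H]. exists j. split; auto.
      pose proof (proj1 H) as J.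
      destruct (nat_trichotomy k j K J) as [C | [C | C]]; auto; exfalso; eapply (A j J); eauto.
Qed.

(** Ordered by its codes under the given injection, [X] has finite initial segments; ranks then
    close the gaps between the codes. *)
Lemma equinumerous_omega X : is_countable w X -> ~ finite X -> equinumerous X w.
Proof.
  intros (c & (F & D & C) & I).
  assert (N : forall x i, maps c x i -> i ∈ w) by exact C.
  apply (order_countable (fun x y => exists i j, maps c x i /\ maps c y j /\ i ∈ j));
    [definable|..].
  - intros x Hx (i & j & Hi & Hj & L).
    rewrite (proj2 F _ _ _ Hi Hj) in L. exact (mem_irrefl _ L).
  - intros x y z _ _ _ (i & j & Hi & Hj & L) (j' & k & Hj' & Hk & L').
    rewrite (proj2 F _ _ _ Hj' Hj) in L'. exists i, k. split; auto. split; auto.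
    eapply nat_trans; eauto.
  - intros x y Hx Hy. apply D in Hx as [i Hi]. apply D in Hy as [j Hj].
    destruct (nat_trichotomy i j) as [L | [-> | L]]; eauto 7.
  - intros y Hy. apply D in Hy as [j Hj].
    destruct (separation (fun x => exists i, maps c x i /\ i ∈ j) X) as [p P]; [definable|].
    exists p. split.
    + apply (finite_image (fun i x => maps c x i) j); [definable|apply nat_finite; eauto|..].
      * intros i x x' _ A B. exact (I _ _ _ A B).
      * intros x Hx. apply P in Hx as [_ (i & Hi & L)]. eauto.
    + intros x Hx (i & j' & Hi & Hj' & L). rewrite (proj2 F _ _ _ Hj' Hj) in L.
      apply P. eauto.
Qed.

Lemma nat_max i j : i ∈ w -> j ∈ w -> exists m, m ∈ w /\ i ∈ m /\ j ∈ m.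
Proof.
  assert (W : forall i j, i ∈ j \/ i = j -> j ∈ w -> exists m, m ∈ w /\ i ∈ m /\ j ∈ m).
  { intros a b L B. destruct (succ_exists b) as [s S]. exists s.
    split; [eapply omega_succ; eauto|]. split; apply S; auto. }
  intros A B. destruct (nat_trichotomy i j A B) as [L | [L | L]]; auto.
  destruct (W j i) as (m & M); auto. exists m. tauto.
Qed.

(** * Ordinals below ω_1 *)

Context (k1 : V) (Hk1 : is_omega1 w k1).

Lemma omega1_transitive : is_transitive k1.
Proof. apply Hk1. Qed.

Lemma omega1_mem x y : x ∈ y -> y ∈ k1 -> x ∈ k1.
Proof. intros X Y. exact (omega1_transitive y Y x X). Qed.

Lemma ordinal_transitive a : a ∈ k1 -> is_transitive a.
Proof.
  intros A y Y z Z. destruct Hk1 as [[_ (_ & T & _)] _].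
  apply (T z y a); eauto using omega1_mem.
Qed.

Lemma ordinal_trichotomy a b : a ∈ k1 -> b ∈ k1 -> a ∈ b \/ a = b \/ b ∈ a.
Proof. destruct Hk1 as [[_ (_ & _ & T & _)] _]. apply T. Qed.

Lemma ordinal_le a b : a ∈ k1 -> b ∈ k1 -> a ∈ b \/ is_subset b a.
Proof.
  intros A B. destruct (ordinal_trichotomy a b A B) as [H | [-> | H]]; auto.
  - right. intros x X; exact X.
  - right. exact (ordinal_transitive a A b H).
Qed.

Lemma ordinal_max a b : a ∈ k1 -> b ∈ k1 ->
  exists c, c ∈ k1 /\ is_subset a c /\ is_subset b c /\ (c = a \/ c = b).
Proof.
  intros A B. destruct (ordinal_le a b A B) as [H | H].
  - exists b. repeat split; auto; [apply ordinal_transitive; auto|intros x; auto].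
  - exists a. repeat split; auto. intros x; auto.
Qed.

(** The least element of ω_1 outside [t] equals [t]; it exists because [a] itself is outside. *)
Lemma transitive_subset_ordinal t a : a ∈ k1 -> is_subset t a -> is_transitive t -> t ∈ k1.
Proof.
  intros A S T.
  destruct (mem_min k1 (fun x => x ∉ t)) as (m & M & N & H).
  - definable.
  - exact omega1_transitive.
  - exists a. split; auto. intro Q. exact (mem_irrefl _ (S a Q)).
  - replace t with m; auto. apply ext. intro x. split.
    + intro X. apply NNPP. auto.
    + intro X. destruct (ordinal_trichotomy x m) as [Q | [-> | Q]]; auto; [|tauto|].
      * apply (omega1_mem _ a); auto.
      * destruct N. exact (T x X m Q).
Qed.

(** Elements are compared by the first index of the cover that contains them,
    and by membership when the indices agree; predecessors are then contained in
    a finite piece of the cover. *)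
Lemma cover_countable (Q : V -> V -> Prop) X : class2 Q -> is_subset X k1 ->
  (forall m, m ∈ w -> exists Y, finite Y /\ forall x, x ∈ X -> Q m x -> x ∈ Y) ->
  (forall x, x ∈ X -> exists m, m ∈ w /\ Q m x) -> is_countable w X.
Proof.
  intros HQ HX Fin Cov.
  set (Q' := fun m x => exists i, (i ∈ m \/ i = m) /\ Q i x).
  assert (HQ' : class2 Q') by (unfold Q'; definable).
  assert (Mono : forall m m' x, m' ∈ w -> m ∈ m' -> Q' m x -> Q' m' x).
  { intros m m' x M' L (i & Hi & H). exists i. split; auto.
    destruct Hi as [Hi | ->]; auto. left. eapply nat_trans; eauto. }
  assert (Cmp : forall m m' x y, m ∈ w -> m' ∈ w -> Q' m x -> ~ Q' m y -> Q' m' y -> Q' m' x).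
  { intros m m' x y M M' Hx Ny Hy.
    destruct (nat_trichotomy m m' M M') as [L | [-> | L]]; eauto. destruct Ny. eauto. }
  assert (Fin' : forall m, m ∈ w -> exists Y, finite Y /\ forall x, x ∈ X -> Q' m x -> x ∈ Y).
  { intros m M. destruct (succ_exists m) as [s S].
    assert (Ws : s ∈ w) by (eapply omega_succ; eauto).
    destruct (finite_union (fun i x => x ∈ X /\ Q i x) s) as (Y & FY & HY);
      [definable|apply nat_finite, Ws|..].
    - intros i Hi. destruct (Fin i) as (Y & FY & HY); [eapply omega_transitive; eauto|].
      exists Y. split; auto. intros x [Hx H]. auto.
    - exists Y. split; auto. intros x Hx (i & Hi & H). apply (HY i); auto. apply S, Hi. }
  set (LT := fun x y => (exists m, m ∈ w /\ Q' m x /\ ~ Q' m y) \/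
    (forall m, m ∈ w -> (Q' m x <-> Q' m y)) /\ x ∈ y).
  assert (HLT : class2 LT) by (unfold LT; definable).
  assert (Le : forall x y m, LT x y -> m ∈ w -> Q' m y -> Q' m x).
  { intros x y m [(m' & M' & A & B) | [E _]] M H; [eauto|]. apply E; auto. }
  apply (order_countable LT X HLT).
  - intros x _ [(m & _ & A & B) | [_ A]]; [tauto|exact (mem_irrefl _ A)].
  - intros x y z Hx Hy Hz L L'. destruct L' as [(m & M & A & B) | [E A]].
    + left. exists m. eauto.
    + destruct L as [(m & M & A' & B') | [E' A']].
      * left. exists m. split; auto. split; auto. rewrite <- E; auto.
      * right. split.
        -- intros m M. rewrite E', E; tauto.
        -- apply (ordinal_transitive z (HX z Hz) y A x A').
  - intros x y Hx Hy. unfold LT.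
    destruct (classic (exists m, m ∈ w /\ Q' m x /\ ~ Q' m y)) as [A | A]; auto.
    destruct (classic (exists m, m ∈ w /\ Q' m y /\ ~ Q' m x)) as [B | B]; auto.
    assert (E : forall m, m ∈ w -> (Q' m x <-> Q' m y)).
    { intros m M. split; intro C; apply NNPP; intro D; [apply A|apply B]; eauto. }
    assert (E' : forall m, m ∈ w -> (Q' m y <-> Q' m x)) by (intros; symmetry; auto).
    destruct (ordinal_trichotomy x y) as [C | [C | C]]; auto.
  - intros y Hy. destruct (Cov y Hy) as (m & M & H).
    destruct (Fin' m M) as (Y & FY & HY). exists Y. split; auto.
    intros x Hx L. apply HY; auto. apply (Le x y); auto. exists m. auto.
Qed.

(** If some ordinal of ω_1 is outside [s], then [s] is a transitive subset of it. Otherwise ω_1 is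
    contained in [s], which an injection of [x] into ω, with [x] added to every piece, covers by
    finite pieces. *)
Lemma omega1_succ s x : x ∈ k1 -> is_succ s x -> s ∈ k1.
Proof.
  intros X S.
  destruct (classic (exists a, a ∈ k1 /\ a ∉ s)) as [(a & A & N) | NE].
  - apply (transitive_subset_ordinal s a A).
    + assert (XA : x ∈ a).
      { destruct (ordinal_trichotomy x a X A) as [H | [-> | H]]; auto;
          destruct N; apply S; auto. }
      intros y Y. apply S in Y as [Y | ->]; auto. exact (ordinal_transitive a A x XA y Y).
    + intros y Y z Z. apply S. left. apply S in Y as [Y | ->]; auto.
      exact (ordinal_transitive x X y Y z Z).
  - exfalso. destruct Hk1 as (_ & NC & CE). apply NC.
    destruct (CE x X) as (c & (F & D & C) & I).
    apply (cover_countable (fun m y => maps c y m \/ y = x)); [definable|..].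
    + intros y Y; exact Y.
    + intros m M. destruct (separation (fun y => maps c y m) x) as [Y0 H0]; [definable|].
      destruct (adjoin_exists Y0 x) as [Y HY]. exists Y. split.
      * apply (finite_adjoin Y Y0 x); auto.
        destruct (succ_exists m) as [t T].
        apply (finite_image (fun i y => maps c y m) t); [definable|..].
        -- apply nat_finite. eapply omega_succ; eauto.
        -- intros i y y' _ A B. exact (I _ _ _ A B).
        -- intros y Hy. apply H0 in Hy as [_ Hy]. exists m. split; auto. apply T; auto.
      * intros y _ [A | ->]; apply HY; auto. left. apply H0. split; auto.
        apply D. eauto.
    + intros y Y. assert (Z : y ∈ s) by (apply NNPP; eauto).
      apply S in Z as [Z | ->].
      * apply D in Z as [m M]. exists m. split; eauto.
      * destruct (empty_exists w) as [e E]. exists e. split; auto. apply omega_empty, E.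
Qed.
(** * Recursion on [ω] *)

Lemma maps_adjoin t' t p s z : is_opair p s z -> is_adjoin t' t p ->
  forall x y, maps t' x y <-> maps t x y \/ x = s /\ y = z.
Proof.
  intros P A x y. split.
  - intros (q & Q & M). apply A in M as [M | ->]; [left; exists q; auto|right].
    exact (opair_inj _ _ _ _ _ Q P).
  - intros [(q & Q & M) | [-> ->]]; [exists q|exists p]; split; auto; apply A; auto.
Qed.

Lemma omega_recursion (G : V -> V -> Prop) X a : class2 G -> a ∈ X ->
  (forall x, x ∈ X -> exists y, y ∈ X /\ G x y) ->
  (forall x y y', x ∈ X -> G x y -> G x y' -> y = y') ->
  exists T : V -> V -> Prop, class2 T /\
    (forall k, k ∈ w -> exists y, y ∈ X /\ T k y) /\
    (forall k y y', k ∈ w -> T k y -> T k y' -> y = y') /\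
    (forall e, is_empty e -> T e a) /\
    (forall k s y z, is_succ s k -> T k y -> G y z -> T s z).
Proof.
  intros HG A Tot Fun.
  (* [t] is an attempt: a set of pairs closed under predecessors *)
  set (T := fun k y => exists t, maps t k y /\
    (forall e y, is_empty e -> maps t e y -> y = a) /\
    (forall j s z, is_succ s j -> maps t s z -> exists y, maps t j y /\ G y z)).
  assert (HT : class2 T) by (unfold T; definable).
  assert (T0 : forall e, is_empty e -> T e a).
  { intros e E. destruct (opair_exists e a) as [p P]. destruct (adjoin_exists e p) as [t B].
    pose proof (maps_adjoin t e p e a P B) as M. exists t. split; [|split].
    - apply M. auto.
    - intros e' y E' H. apply M in H as [(q & _ & Q) | [_ ->]]; auto. destruct (E q Q).
    - intros j s z S H. apply M in H as [(q & _ & Q) | [-> _]]; [destruct (E q Q)|].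
      destruct (E j). apply S. auto. }
  assert (TS : forall k s y z, is_succ s k -> T k y -> G y z -> T s z).
  { intros k s y z S (t & Y & H0 & H1) H. destruct (opair_exists s z) as [p P].
    destruct (adjoin_exists t p) as [t' B].
    pose proof (maps_adjoin t' t p s z P B) as M. exists t'. split; [|split].
    - apply M. auto.
    - intros e y' E H'. apply M in H' as [H' | [-> _]]; eauto. destruct (E k). apply S; auto.
    - intros j s' z' S' H'. apply M in H' as [H' | [-> ->]].
      + destruct (H1 j s' z' S' H') as (u & Hu & Gu). exists u. split; auto. apply M; auto.
      + rewrite (succ_inj _ _ _ S' S). exists y. split; auto. apply M; auto. }
  exists T. repeat split; auto.
  - apply (omega_ind (fun k => exists y, y ∈ X /\ T k y)); [definable|eauto|].
    intros k s K (y & Y & Ty) S. destruct (Tot y Y) as (z & Z & H). eauto.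
  - intros k y y' K H H'.
    (* Attempts need not be functions; the value at [k] is pinned down by induction for all attempts
       together. It is kept in [X], where [G] is single-valued. *)
    assert (Q : exists x, x ∈ X /\ forall u, T k u -> u = x).
    { clear y y' H H'. revert k K.
      apply (omega_ind (fun k => exists x, x ∈ X /\ forall u, T k u -> u = x)); [definable|..].
      - intros e E. exists a. split; auto. intros u (t & M & H0 & _). eauto.
      - intros k s K (x & Hx & U) S. destruct (Tot x Hx) as (z & Z & H). exists z. split; auto.
        intros u (t & M & H0 & H1). destruct (H1 k s u S M) as (v & Hv & Gv).
        rewrite (U v) in Gv by (exists t; auto). eauto. }
    destruct Q as (x & _ & U). rewrite (U y H), (U y' H'). reflexivity.
Qed.

(** * Uniform denumerations give essential disjointness *)

Section UniformDenumeration.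
Context (e : V) (He : uniform_denumeration w k1 e).

(** The first [m] values of the surjection [e(a)]. The conjunct [x ∈ a] makes [a] nonempty, as the
    hypothesis on [e] requires. *)
Definition approx (a m x : V) : Prop :=
  x ∈ a /\ exists g i, maps e a g /\ i ∈ m /\ maps g i x.

Lemma approx_finite a m : a ∈ k1 -> m ∈ w ->
  exists Y, finite Y /\ forall x, approx a m x -> x ∈ Y.
Proof.
  intros A M. destruct (separation (fun x => approx a m x) a) as [Y H].
  { unfold approx; definable. }
  exists Y. split; [|intros x X; apply H; split; auto; apply X].
  apply (finite_image (fun i x => x ∈ a /\ exists g, maps e a g /\ maps g i x) m);
    [definable|apply nat_finite, M|..].
  - intros i x x' _ (X & g & Hg & Hx) (X' & g' & Hg' & Hx').
    destruct He as (F & D & U). rewrite (proj2 F _ _ _ Hg' Hg) in Hx'.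
    assert (Fg : function_onto g w a). { apply U; auto. intro E. exact (E x X). }
    apply (proj2 (proj1 Fg) _ _ _ Hx Hx').
  - intros x X. apply H in X as (_ & X & g & i & Hg & Hi & Hx). exists i. eauto.
Qed.

Lemma approx_mono a m m' x : m' ∈ w -> m ∈ m' -> approx a m x -> approx a m' x.
Proof.
  intros M' L (X & g & i & Hg & Hi & Hx). split; auto. exists g, i.
  split; auto. split; auto. eapply nat_trans; eauto.
Qed.

Lemma approx_cover a x : a ∈ k1 -> x ∈ a -> exists m, m ∈ w /\ approx a m x.
Proof.
  intros A X. destruct He as (F & D & U). destruct (proj1 (D a) A) as [g Hg].
  assert (Fg : function_onto g w a). { apply U; auto. intro E. exact (E x X). }
  destruct Fg as (_ & Dg & Rg). destruct (proj1 (Rg x) X) as [i Hi].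
  destruct (succ_exists i) as [s S]. exists s. split.
  - eapply omega_succ; eauto. apply Dg. eauto.
  - split; auto. exists g, i. repeat split; auto. apply S. auto.
Qed.

Lemma approx_max a i j : i ∈ w -> j ∈ w ->
  exists m, m ∈ w /\ forall x, approx a i x \/ approx a j x -> approx a m x.
Proof.
  intros I J. destruct (nat_max i j I J) as (m & M & L & L').
  exists m. split; auto. intros x [H | H]; eauto using approx_mono.
Qed.

(** If the least witnesses [y_m] had no common bound, every ordinal would lie at or below some
    [y_m], and the finite approximations of the [y_m] would cover ω_1 by ω finite sets. The uniform
    denumeration enumerates all [y_m] simultaneously, which is where choice would otherwise
    enter. *)
Lemma omega1_regular (R : V -> V -> Prop) : class2 R ->
  (forall m, m ∈ w -> exists y, y ∈ k1 /\ R m y) ->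
  exists b, b ∈ k1 /\ forall m, m ∈ w -> exists y, y ∈ b /\ R m y.
Proof.
  intros HR Tot. apply NNPP. intro N.
  set (S := fun m y => y ∈ k1 /\ R m y /\ forall z, z ∈ y -> ~ R m z).
  assert (HS : class2 S) by (unfold S; definable).
  assert (ST : forall m, m ∈ w -> exists y, S m y).
  { intros m M. apply (mem_min k1 (fun y => R m y)); auto using omega1_transitive. definable. }
  assert (SU : forall m y y', S m y -> S m y' -> y = y').
  { intros m y y' (A & B & C) (A' & B' & C').
    destruct (ordinal_trichotomy y y' A A') as [H | [H | H]]; auto.
    - destruct (C' y H B).
    - destruct (C y' H B'). }
  destruct Hk1 as (_ & NC & _). apply NC.
  apply (cover_countable (fun m x => exists i y, i ∈ m /\ S i y /\ (x = y \/ approx y m x))).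
  - unfold approx; definable.
  - intros x X; exact X.
  - intros m M.
    destruct (finite_union (fun i x => exists y, S i y /\ (x = y \/ approx y m x)) m)
      as (Y & FY & HY); [unfold approx; definable|apply nat_finite, M|..].
    + intros i Hi. destruct (ST i) as [y Sy]; [eapply omega_transitive; eauto|].
      destruct (approx_finite y m) as (Y & FY & HY); [apply Sy|auto|].
      destruct (adjoin_exists Y y) as [Z HZ]. exists Z. split; [eapply finite_adjoin; eauto|].
      intros x (y' & Sy' & H). rewrite (SU _ _ _ Sy' Sy) in H. apply HZ.
      destruct H as [-> | H]; auto.
    + exists Y. split; auto. intros x _ (i & y & Hi & H). eauto.
  - intros x X.
    assert (Q : exists m, m ∈ w /\ forall y, y ∈ x -> ~ R m y).
    { apply NNPP. intro Q. apply N. exists x. split; auto. intros m M.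
      apply NNPP. intro Q'. apply Q. exists m. split; auto. intros y Y Ry. eauto. }
    destruct Q as (m & M & Hm). destruct (ST m M) as [y Sy].
    destruct (ordinal_trichotomy x y X (proj1 Sy)) as [H | [-> | H]].
    + destruct (approx_cover y x (proj1 Sy) H) as (j & J & Hj).
      destruct (nat_max m j M J) as (l & L & L1 & L2). exists l. split; auto.
      exists m, y. eauto using approx_mono.
    + destruct (succ_exists m) as [s Hs]. exists s. split; [eapply omega_succ; eauto|].
      exists m, y. repeat split; try apply Sy; auto. apply Hs; auto.
    + destruct (Hm y H). apply Sy.
Qed.

(** * Absorbing ordinals, levels and the points to remove *)

Context (n : V) (Hn : n ∈ w) (F : V).
Context (HF : forall A, A ∈ F -> is_subset A k1 /\ equinumerous A w)
  (AD : almost_disjoint n F).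

Definition large (A g : V) : Prop := exists d, is_inter d A g /\ ~ card_lt d n.

Definition large_at (A g m : V) : Prop :=
  exists d, (forall x, x ∈ d <-> x ∈ A /\ approx g m x) /\ ~ card_lt d n.

Definition absorbing (g : V) : Prop :=
  g ∈ k1 /\ forall A, A ∈ F -> large A g -> is_subset A g.

Definition level (A g : V) : Prop :=
  absorbing g /\ is_subset A g /\ forall h, h ∈ g -> absorbing h -> ~ is_subset A h.

Lemma inter_exists a b : exists d, is_inter d a b.
Proof. apply separation. definable. Qed.

Lemma family_infinite A : A ∈ F -> ~ finite A.
Proof.
  intros H Fin. apply omega_infinite. eapply equinumerous_finite; eauto. apply HF, H.
Qed.

Lemma large_of_subset A g : A ∈ F -> is_subset A g -> large A g.
Proof.
  intros H S. exists A. split.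
  - intro x. split; [auto|tauto].
  - intro L. apply (family_infinite A H). eapply card_lt_finite; eauto.
Qed.

Lemma family_eq A B d : A ∈ F -> B ∈ F -> ~ card_lt d n ->
  is_subset d A -> is_subset d B -> A = B.
Proof.
  intros HA HB N SA SB. apply NNPP. intro Q. apply N.
  destruct (inter_exists A B) as [c C].
  apply (card_lt_subset c); [auto|apply (AD A B); auto|].
  intros x X. apply C. auto.
Qed.

(** The trace on the finite approximation has at least [n] points, so it determines the member by
    almost disjointness, and a finite set has only finitely many subsets. *)
Lemma large_at_finite g m : g ∈ k1 -> m ∈ w ->
  exists E, finite E /\ forall A, A ∈ F -> large_at A g m -> A ∈ E.
Proof.
  intros G M. destruct (approx_finite g m G M) as (Y & FY & HY).
  destruct (zf_powerset V HZF Y) as [p P].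
  assert (Fp : finite p). { apply (powerset_finite Y); auto. intros y Hy. apply P, Hy. }
  destruct (separation (fun A => large_at A g m) F) as [E HE].
  { unfold large_at, approx; definable. }
  exists E. split; [|intros; apply HE; auto].
  apply (finite_image (fun d A => A ∈ F /\ ~ card_lt d n /\
    (forall x, x ∈ d <-> x ∈ A /\ approx g m x)) p); [unfold approx; definable|auto|..].
  - intros d A B _ (HA & N & DA) (HB & _ & DB).
    apply (family_eq A B d); auto; intros x X; [apply DA, X|apply DB, X].
  - intros A HA. apply HE in HA as (HA & d & D & N). exists d. split; auto.
    apply P. intros x X. apply HY, D, X.
Qed.

Lemma large_at_exists A g : g ∈ k1 -> large A g -> exists m, m ∈ w /\ large_at A g m.
Proof.
  intros G (d & D & N).
  destruct (card_ge_directed (fun x m => approx g m x) w d n) as (m & M & H);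
    auto.
  - unfold approx; definable.
  - exists n; auto.
  - intros i j I J. exact (approx_max g i j I J).
  - intros x X. apply approx_cover; auto. apply D, X.
  - exists m. split; auto.
    destruct (separation (fun x => approx g m x) A) as [c C]; [unfold approx; definable|].
    exists c. split; auto. apply H. intro x. rewrite C, (D x).
    split; [|tauto]. intros [X Y]. split; auto. split; auto. apply Y.
Qed.

(** For each member the stages of largeness are closed upwards in ω, and two such sets of numbers
    are comparable. *)
Lemma large_at_compare A B g :
  (forall m, m ∈ w -> large_at A g m -> large_at B g m) \/
  (forall m, m ∈ w -> large_at B g m -> large_at A g m).
Proof.
  assert (Mono : forall A m m', m' ∈ w -> m ∈ m' -> large_at A g m -> large_at A g m').
  { intros C m m' M L (d & D & N).
    destruct (separation (fun x => approx g m' x) C) as [c Hc]; [unfold approx; definable|].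
    exists c. split; auto. intro Q. apply N. apply (card_lt_subset c); auto.
    intros x X. apply D in X as [X Y]. apply Hc. eauto using approx_mono. }
  destruct (classic (forall m, m ∈ w -> large_at A g m -> large_at B g m)) as [H | H]; auto.
  right. intros m M Bm. apply NNPP. intro NA. apply H. intros m' M' Am'.
  destruct (nat_trichotomy m m' M M') as [L | [-> | L]]; eauto. destruct NA. eauto.
Qed.

(** Regularity along an enumeration of [A]; only one enumeration is needed, so it may simply be
    picked. *)
Lemma family_bounded A : A ∈ F -> exists b, b ∈ k1 /\ is_subset A b.
Proof.
  intros HA. destruct (HF A HA) as [SA EA].
  destruct (equinumerous_elim _ _ EA) as (f & D & T & U & I & O).
  destruct (omega1_regular (fun m y => maps f y m)) as (b & B & H).
  - definable.
  - intros m M. destruct (O m M) as [y Y]. exists y. split; auto. apply SA, (D _ _ Y).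
  - exists b. split; auto. intros x X. destruct (T x X) as [m M].
    destruct (H m) as (y & Y & My); [apply (D _ _ M)|]. rewrite (I _ _ _ M My). exact Y.
Qed.

Lemma ordinal_directed i j : i ∈ k1 -> j ∈ k1 ->
  exists k, k ∈ k1 /\ forall x, is_subset x i \/ is_subset x j -> is_subset x k.
Proof.
  intros I J. destruct (ordinal_max i j I J) as (k & K & S & S' & _).
  exists k. split; auto. intros x [X | X] y Y; auto.
Qed.

(** At each stage [m] only finitely many members are large, so they have a common bound; regularity
    then bounds all stages together. *)
Lemma absorb_step b : b ∈ k1 ->
  exists g, g ∈ k1 /\ b ∈ g /\ forall A, A ∈ F -> large A b -> is_subset A g.
Proof.
  intro B.
  destruct (omega1_regular (fun m g => forall A, A ∈ F -> large_at A b m -> is_subset A g))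
    as (g & G & H).
  - unfold large_at, approx; definable.
  - intros m M. destruct (large_at_finite b m B M) as (E & FE & HE).
    destruct (separation (fun A => A ∈ F) E) as [E' HE']; [definable|].
    destruct (finite_directed (fun A g => is_subset A g) k1 E') as (g & G & H).
    + definable.
    + apply (finite_subset E); auto. intros A HA. apply HE', HA.
    + eauto.
    + exact ordinal_directed.
    + intros A HA. apply family_bounded. apply HE', HA.
    + exists g. split; auto. intros A HA L. apply H, HE'. auto.
  - destruct (succ_exists b) as [s S].
    destruct (ordinal_max g s G (omega1_succ s b B S)) as (c & C & S1 & S2 & _).
    exists c. split; auto. split; [apply S2, S; auto|].
    intros A HA L. destruct (large_at_exists A b B L) as (m & M & Lm).
    destruct (H m M) as (y & Y & Hy). intros x X. apply S1.
    apply (ordinal_transitive g G y Y). apply (Hy A HA Lm x X).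
Qed.

(** The least ordinal given by [absorb_step] is iterated ω times and the union is taken; largeness
    in the union is already largeness in some iterate. *)
Lemma absorbing_unbounded b : b ∈ k1 -> exists g, absorbing g /\ is_subset b g.
Proof.
  intro B.
  set (P := fun b g => g ∈ k1 /\ b ∈ g /\ forall A, A ∈ F -> large A b -> is_subset A g).
  assert (HP : class2 P) by (unfold P, large; definable).
  set (G := fun b g => P b g /\ forall h, h ∈ g -> ~ P b h).
  assert (HG : class2 G) by (unfold G; definable).
  assert (TotG : forall x, x ∈ k1 -> exists y, y ∈ k1 /\ G x y).
  { intros x X. destruct (mem_min k1 (fun g => P x g)) as (g & K & Pg & M).
    - definable.
    - exact omega1_transitive.
    - destruct (absorb_step x X) as (g & K). exists g. split; auto. apply K.
    - exists g. split; auto. split; auto. }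
  destruct (omega_recursion G k1 b) as (T & HT & Tot & U & T0 & TS); auto.
  - intros x y y' X [Py M] [Py' M'].
    destruct (ordinal_trichotomy y y') as [H | [H | H]]; auto.
    + apply Py.
    + apply Py'.
    + destruct (M' y); auto.
    + destruct (M y'); auto.
  - destruct (omega1_regular T HT Tot) as (c & C & HC).
    assert (In : forall m y, m ∈ w -> T m y -> y ∈ c).
    { intros m y M Ty. destruct (HC m M) as (y' & Y' & Ty'). rewrite (U m y y'); auto. }
    (* The union of the iterates, cut out of their common bound [c]; as a transitive subset of [c]
       it belongs to ω_1. *)
    destruct (separation (fun x => exists m y, m ∈ w /\ T m y /\ x ∈ y) c) as [g Hg];
      [definable|].
    assert (Sub : forall m y, m ∈ w -> T m y -> is_subset y g).
    { intros m y M Ty x X. apply Hg. split; [|eauto].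
      apply (ordinal_transitive c C y); eauto. }
    assert (Kg : g ∈ k1).
    { apply (transitive_subset_ordinal g c C).
      - intros x X. apply Hg, X.
      - intros x X z Z. apply Hg in X as [X (m & y & M & Ty & Y)].
        apply (Sub m y M Ty). apply (ordinal_transitive y) with x; auto.
        apply (omega1_mem y c); eauto. }
    exists g. split; [split; auto|].
    + intros A HA (d & D & N).
      destruct (card_ge_directed (fun x m => exists y, T m y /\ x ∈ y) w d n)
        as (m & M & H); [definable|exact Hn|exists n; exact Hn|..].
      * intros i j I J. destruct (Tot i I) as (y & Y & Ty). destruct (Tot j J) as (z & Z & Tz).
        destruct (ordinal_max y z Y Z) as (v & _ & S1 & S2 & [-> | ->]);
          [exists i|exists j]; split; auto; intros x [(u & Tu & X) | (u & Tu & X)];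
          [rewrite (U _ _ _ I Tu Ty) in X|rewrite (U _ _ _ J Tu Tz) in X
          |rewrite (U _ _ _ I Tu Ty) in X|rewrite (U _ _ _ J Tu Tz) in X]; eauto.
      * intros x X. apply D in X as [_ X]. apply Hg in X as [_ (m & y & M & Ty & Y)]. eauto.
      * exact N.
      (* [A] is large in the iterate [y], so the next iterate [z] contains [A], and [z] is part of
         the union. *)
      * destruct (Tot m M) as (y & Y & Ty). destruct (TotG y Y) as (z & Z & Gz).
        destruct (succ_exists m) as [s S].
        assert (Az : is_subset A z).
        { apply Gz; auto. destruct (inter_exists A y) as [c' C']. exists c'. split; auto.
          apply H. intro x. rewrite (C' x), (D x). split.
          - intros [X X']. split; [|eauto]. split; auto. exact (Sub m y M Ty x X').
          - intros [[X _] (y' & Ty' & X')]. rewrite (U m y' y) in X'; auto. }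
        intros x X. apply (Sub s z); eauto using omega_succ.
    + destruct (empty_exists w) as [o O]. exact (Sub o b (omega_empty o O) (T0 o O)).
Qed.

Lemma level_exists A : A ∈ F -> exists g, level A g.
Proof.
  intros HA. destruct (family_bounded A HA) as (b & B & S).
  destruct (absorbing_unbounded b B) as (g & G & S').
  destruct (mem_min k1 (fun g => absorbing g /\ is_subset A g)) as (h & H & [Ah Sh] & M).
  - unfold absorbing, large; definable.
  - exact omega1_transitive.
  - exists g. split; [apply G|]. split; auto. intros x X; auto.
  - exists h. repeat split; auto; try apply Ah. intros i I Ai Si. apply (M i I). auto.
Qed.

(** The ordinals in question form a chain, so if [d] were infinite, one of them would contain [n]
    points of [A]; being absorbing, it would contain all of [A]. *)
Lemma below_level_finite A d : A ∈ F ->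
  (forall x, x ∈ d <-> x ∈ A /\ exists g, absorbing g /\ ~ is_subset A g /\ x ∈ g) ->
  finite d.
Proof.
  intros HA D. apply NNPP. intro Inf.
  destruct (separation (fun g => absorbing g /\ ~ is_subset A g) k1) as [I HI].
  { unfold absorbing, large; definable. }
  assert (II : forall g, absorbing g -> ~ is_subset A g -> g ∈ I).
  { intros g G N. apply HI. split; auto. apply G. }
  destruct (classic (exists i, i ∈ I)) as [NE | E].
  - destruct (card_ge_directed (fun x g => x ∈ g) I d n) as (g & G & H).
    + definable.
    + exact Hn.
    + exact NE.
    + intros i j Hi Hj. pose proof (proj1 (HI i) Hi) as [Ki _].
      pose proof (proj1 (HI j) Hj) as [Kj _].
      destruct (ordinal_max i j Ki Kj) as (k & _ & S1 & S2 & Q).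
      exists k. split; [destruct Q as [-> | ->]; auto|]. intros x [X | X]; auto.
    + intros x X. apply D in X as [_ (g & Ag & N & X)]. eauto.
    + intro L. apply Inf. eapply card_lt_finite; eauto.
    + apply HI in G as [_ [Ag N]]. apply N, Ag; auto.
      destruct (inter_exists A g) as [c C]. exists c. split; auto.
      apply H. intro x. rewrite (C x), D. split; [|tauto].
      intros [X Y]. repeat split; auto. exists g. auto.
  - apply Inf, finite_empty. intros x X. apply D in X as [_ (g & Ag & N & X)]. eauto.
Qed.

(** [A] is infinite, hence large at some stage [m], and every competing [B] is large at that stage
    too. So there are finitely many competitors, each meeting [A] in fewer than [n] points. *)
Lemma same_level_finite A d : A ∈ F ->
  (forall x, x ∈ d -> x ∈ A /\ exists B g, B ∈ F /\ B <> A /\ x ∈ B /\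
     level A g /\ level B g /\ forall m, m ∈ w -> large_at A g m -> large_at B g m) ->
  finite d.
Proof.
  intros HA D. destruct (classic (exists x, x ∈ d)) as [[x0 X0] | E];
    [|apply finite_empty; intros x X; eauto].
  destruct (D x0 X0) as (_ & _ & g & _ & _ & _ & Lg & _ & _). clear x0 X0.
  assert (G : g ∈ k1) by apply Lg.
  destruct (large_at_exists A g G) as (m & M & Lm).
  { apply large_of_subset; auto. apply Lg. }
  destruct (large_at_finite g m G M) as (E & FE & HE).
  destruct (finite_union (fun B x => B ∈ F /\ B <> A /\ x ∈ A /\ x ∈ B) E)
    as (Y & FY & HY); [definable|exact FE|..].
  - intros B _. destruct (inter_exists A B) as [c C].
    destruct (classic (B ∈ F /\ B <> A)) as [[HB N] | N].
    + exists c. split.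
      * apply (card_lt_finite c n); auto. apply (AD A B); auto.
      * intros x (_ & _ & X & X'). apply C. auto.
    (* Default case: no point has to be covered, and [n] is a finite set at hand. *)
    + exists n. split; [apply nat_finite; auto|]. tauto.
  - apply (finite_subset Y); auto. intros x X.
    destruct (D x X) as (XA & B & h & HB & N & XB & Lh & LB & Cmp).
    (* A member has only one level: of two distinct ones, the smaller would violate the minimality
       of the larger. *)
    replace h with g in *.
    + apply (HY B x); auto.
    + destruct (ordinal_trichotomy g h) as [Q | [Q | Q]]; auto; try apply Lh.
      * destruct Lh as (_ & _ & Lh). destruct (Lh g Q); apply Lg.
      * destruct Lg as (_ & _ & Lg). destruct (Lg h Q); apply Lh.
Qed.

Lemma essentially_disjoint_of_denumeration : essentially_disjoint w F.
Proof.
  set (Phi := fun A s => forall x, x ∈ s <-> x ∈ A /\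
    ((exists g, absorbing g /\ ~ is_subset A g /\ x ∈ g) \/
     (exists B g, B ∈ F /\ B <> A /\ x ∈ B /\ level A g /\ level B g /\
        forall m, m ∈ w -> large_at A g m -> large_at B g m))).
  destruct (function_exists Phi F) as (f & Ff & Df & Mf).
  - unfold Phi, level, absorbing, large, large_at, approx; definable.
  - intros A HA. apply separation.
    unfold level, absorbing, large, large_at, approx; definable.
  - intros A s s' _ S S'. apply ext. intro x. rewrite (S x), (S' x). tauto.
  - exists f. split; auto. split; auto. split.
    + intros A s M. apply Mf in M as [HA S]. split; [intros x X; apply S, X|].
      destruct (separation (fun x => exists g, absorbing g /\ ~ is_subset A g /\ x ∈ g) A)
        as [d1 D1]; [unfold absorbing, large; definable|].
      destruct (separation (fun x => exists B g, B ∈ F /\ B <> A /\ x ∈ B /\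
          level A g /\ level B g /\ forall m, m ∈ w -> large_at A g m -> large_at B g m) A)
        as [d2 D2]; [unfold level, absorbing, large, large_at, approx; definable|].
      destruct (finite_cup d1 d2) as (c & C & S1 & S2).
      * apply (below_level_finite A); auto.
      * apply (same_level_finite A); auto. intros x X. apply D2, X.
      * apply (finite_subset c); auto. intros x X. apply S in X as [X [H | H]].
        -- apply S1, D1; auto.
        -- apply S2, D2; auto.
    + intros A B s t C D MA MB N HC HD (x & XC & XD).
      apply Mf in MA as [HA SA], MB as [HB SB].
      apply HC in XC as [XA Ns]. apply HD in XD as [XB Nt].
      destruct (level_exists A HA) as [g Lg]. destruct (level_exists B HB) as [h Lh].
      (* If the levels differ, the smaller one is absorbing, contains [x] and, by minimality, does
         not contain the member of larger level, which has therefore lost [x]. If they agree, the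
         comparison of stages tells which member lost it. *)
      destruct (ordinal_trichotomy g h) as [Q | [<- | Q]]; try apply Lg; try apply Lh.
      * apply Nt, SB. split; auto. left. exists g. split; [apply Lg|]. split.
        -- apply Lh; auto. apply Lg.
        -- apply Lg, XA.
      * destruct (large_at_compare A B g) as [Q | Q].
        -- apply Ns, SA. split; auto. right. exists B, g. auto 10.
        -- apply Nt, SB. split; auto. right. exists A, g. auto 10.
      * apply Ns, SA. split; auto. left. exists h. split; [apply Lh|]. split.
        -- apply Lg; auto. apply Lh.
        -- apply Lh, XB.
Qed.

End UniformDenumeration.
(** * Singular [ω_1] refutes essential disjointness *)

Definition limit (l : V) : Prop := l ∈ k1 /\ ~ exists y, is_succ l y.

(** [x = l + i] *)
Definition point (l i x : V) : Prop :=
  limit l /\ i ∈ w /\ x ∈ k1 /\ is_subset l x /\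
  exists d, is_diff d x l /\ equinumerous d i.

Lemma diff_exists a b : exists d, is_diff d a b.
Proof. apply separation. definable. Qed.

Lemma point_zero l o : limit l -> is_empty o -> point l o l.
Proof.
  intros L O. split; auto. split; [apply omega_empty, O|]. split; [apply L|].
  split; [intros x X; exact X|]. destruct (diff_exists l l) as [d D]. exists d. split; auto.
  apply equinumerous_of_empty; auto. intros x X. apply D in X. tauto.
Qed.

Lemma point_succ l i i' x x' : point l i x -> is_succ i' i -> is_succ x' x -> point l i' x'.
Proof.
  intros (L & I & X & S & d & D & G) HI HX. split; auto.
  split; [eapply omega_succ; eauto|]. split; [eapply omega1_succ; eauto|].
  split; [intros y Y; apply HX; auto|].
  destruct (diff_exists x' l) as [d' D']. exists d'. split; auto.
  apply (equinumerous_adjoin d' d x i' i); auto.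
  - intro z. rewrite (D' z), (D z), (HX z). split; [tauto|].
    intros [? | ->]; [tauto|]. split; auto. intro Q. exact (mem_irrefl x (S x Q)).
  - rewrite (D x). intros [Q _]. exact (mem_irrefl x Q).
Qed.

Lemma point_exists l i : limit l -> i ∈ w -> exists x, point l i x.
Proof.
  intros L I. revert i I. apply (omega_ind (fun i => exists x, point l i x)).
  - unfold point, limit; definable.
  - intros o O. exists l. apply point_zero; auto.
  - intros i s I [x X] S. destruct (succ_exists x) as [x' X'].
    exists x'. eapply point_succ; eauto.
Qed.

(** For [y ∈ y'], the part of [y] above [l] is a proper subset of that of [y'], so the two cannot
    both have [i] elements. *)
Lemma point_unique l i x x' : point l i x -> point l i x' -> x = x'.
Proof.
  assert (W : forall x x', point l i x -> point l i x' -> ~ x ∈ x').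
  { intros y y' (L & I & Y & S & d & D & G) (_ & _ & Y' & S' & d' & D' & G') Q.
    apply (mem_irrefl i). apply (card_proper_subset d' d y); auto.
    - intros z Z. apply D in Z as [Z N]. apply D'. split; auto.
      exact (ordinal_transitive y' Y' y Q z Z).
    - apply D'. split; auto. intro N. exact (mem_irrefl y (S y N)).
    - rewrite (D y). intros [N _]. exact (mem_irrefl y N). }
  intros P P'. destruct (ordinal_trichotomy x x') as [Q | [Q | Q]]; auto.
  - apply P.
  - apply P'.
  - destruct (W x x'); auto.
  - destruct (W x' x); auto.
Qed.

(** If [l ∈ l'], the part of [l'] above [l] is nonempty and contained in a finite set; its greatest
    element [z] gives [l' = z + 1], so [l'] is not a limit. *)
Lemma point_base l l' i j x : point l i x -> point l' j x -> l = l'.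
Proof.
  assert (W : forall l l' i j, point l i x -> point l' j x -> ~ l ∈ l').
  { clear l l' i j. intros l l' i j ((Kl & _) & I & X & S & d & D & G) (L' & _ & _ & S' & _) Q.
    destruct (diff_exists l' l) as [c C].
    assert (Kl' : l' ∈ k1) by apply L'.
    assert (Kc : forall y, y ∈ c -> y ∈ k1).
    { intros y Y. apply C in Y as [Y _]. exact (omega1_mem y l' Y Kl'). }
    destruct (finite_directed (fun u v => u ∈ v \/ u = v) c c) as (z & Z & M).
    - definable.
    - apply (finite_subset d); [exists i; auto|]. intros y Y. apply C in Y as [Y N].
      apply D. auto.
    - exists l. apply C. split; [exact Q|exact (mem_irrefl l)].
    - intros u v Hu Hv. destruct (ordinal_trichotomy u v) as [H | [-> | H]]; auto.
      + exists v. split; auto. intros t [[T | ->] | T]; auto. left.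
        exact (ordinal_transitive v (Kc v Hv) u H t T).
      + exists v. split; auto. tauto.
      + exists u. split; auto. intros t [T | [T | ->]]; auto. left.
        exact (ordinal_transitive u (Kc u Hu) v H t T).
    - eauto.
    - apply (proj2 L'). exists z. pose proof (proj1 (C z) Z) as [Zl' Zl]. intro y. split.
      + intro Y. destruct (classic (y ∈ l)) as [H | H].
        * left. destruct (ordinal_le z l (Kc z Z) Kl) as [B | B]; [tauto|auto].
        * apply M, C. auto.
      + intros [Y | ->]; auto. exact (ordinal_transitive l' Kl' z Zl' y Y). }
  intros P P'. destruct (ordinal_trichotomy l l') as [Q | [Q | Q]]; auto.
  - apply P.
  - apply P'.
  - destruct (W l l' i j); auto.
  - destruct (W l' l j i); auto.
Qed.

Lemma point_index l i j x : point l i x -> point l j x -> i = j.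
Proof.
  intros (_ & I & _ & _ & d & D & G) (_ & J & _ & _ & d' & D' & G').
  replace d' with d in G' by (apply ext; intro z; rewrite (D z), (D' z); tauto).
  eapply nat_card_unique; eauto.
Qed.

Lemma point_cover x : x ∈ k1 -> exists l i, point l i x.
Proof.
  intros X. apply NNPP. intro N.
  destruct (mem_min k1 (fun x => ~ exists l i, point l i x)) as (y & Y & Ny & M).
  - unfold point, limit; definable.
  - exact omega1_transitive.
  - eauto.
  - apply Ny. destruct (classic (exists z, is_succ y z)) as [[z Z] | L].
    + assert (Q : exists l i, point l i z) by (apply NNPP, M, Z; auto).
      destruct Q as (l & i & P). destruct (succ_exists i) as [s S].
      exists l, s. eapply point_succ; eauto.
    + destruct (empty_exists w) as [o O]. exists y, o. apply point_zero; auto. split; auto.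
Qed.

(** An injection of the limits into ω would cover ω_1 by finite sets: the [m]-th contains the
    [l + i] where [i] and the code of [l] are below [m]. *)
Lemma limits_uncountable L : (forall x, x ∈ L <-> limit x) -> ~ is_countable w L.
Proof.
  intros HL (c & (F & D & C) & I). apply Hk1.
  apply (cover_countable (fun m x => exists l i j,
    point l i x /\ i ∈ m /\ maps c l j /\ j ∈ m)).
  - unfold point, limit; definable.
  - intros x X; exact X.
  - intros m M.
    destruct (finite_union (fun j x => exists l i, maps c l j /\ i ∈ m /\ point l i x) m)
      as (Y & FY & HY); [unfold point, limit; definable|apply nat_finite, M|..].
    + intros j J.
      destruct (separation (fun x => exists l i, maps c l j /\ i ∈ m /\ point l i x) k1)
        as [Y HY]; [unfold point, limit; definable|].
      exists Y. split.
      * apply (finite_image (fun i x => exists l, maps c l j /\ point l i x) m);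
          [unfold point, limit; definable|apply nat_finite, M|..].
        -- intros i x x' _ (l & Hl & P) (l' & Hl' & P').
           rewrite (I _ _ _ Hl' Hl) in P'. eapply point_unique; eauto.
        -- intros x X. apply HY in X as (_ & l & i & Hl & Hi & P). eauto.
      * intros x (l & i & Hl & Hi & P). apply HY. split; [apply P|eauto].
    + exists Y. split; auto. intros x _ (l & i & j & P & Hi & Hl & Hj). apply (HY j); eauto.
  - intros x X. destruct (point_cover x X) as (l & i & P).
    destruct (proj1 (D l)) as [j Hj]; [apply HL, P|].
    destruct (nat_max i j) as (m & M & H & H'); [apply P|eauto|].
    exists m. split; auto. exists l, i, j. auto.
Qed.

(** Otherwise all initial segments of [L] would be finite and membership would order it countably.
    The resulting [a] is what makes every column infinite. *)
Lemma limits_below_infinite L : (forall x, x ∈ L <-> limit x) ->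
  exists a, a ∈ k1 /\ forall d, is_inter d L a -> ~ finite d.
Proof.
  intro HL. apply NNPP. intro N. apply (limits_uncountable L HL).
  assert (K : forall x, x ∈ L -> x ∈ k1) by (intros x X; apply HL, X).
  apply (order_countable (fun x y => x ∈ y)).
  - definable.
  - intros x _. exact (mem_irrefl x).
  - intros x y z _ _ Z X Y. exact (ordinal_transitive z (K z Z) y Y x X).
  - intros x y X Y. apply ordinal_trichotomy; auto.
  - intros y Y. apply NNPP. intro Q. apply N. exists y. split; auto.
    intros d D Fd. apply Q. exists d. split; auto. intros x X H. apply D. auto.
Qed.

Lemma card_lt_two two d : is_numeral 2 two ->
  (forall x y, x ∈ d -> y ∈ d -> x = y) -> card_lt d two.
Proof.
  intros (s & (o & O & S) & T) H. cbn in O.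
  destruct (classic (exists x, x ∈ d)) as [[x X] | N].
  - exists s. split; [apply T; auto|].
    apply (equinumerous_adjoin d o x s o); auto using equinumerous_refl.
    intro z. split; [auto|]. intros [Z | ->]; auto. destruct (O z Z).
  - exists o. split; [apply T; left; apply S; auto|].
    apply equinumerous_of_empty; auto. intros x X. eauto.
Qed.

(** * The family of columns and blocks *)

Section Singular.
Context (two : V) (Htwo : is_numeral 2 two) (M2 : M_ED w k1 two).
Context (L : V) (HL : forall x, x ∈ L <-> limit x).
Context (c0 g : V) (C0 : c0 ∈ k1) (Hg : function_into g c0 k1)
  (Cof : forall a, a ∈ k1 -> exists x y, maps g x y /\ is_subset a y).
Context (c : V) (Hc : function_into c c0 w) (Ic : is_injective c).
Context (a0 : V) (A0 : a0 ∈ k1) (Inf0 : forall d, is_inter d L a0 -> ~ finite d).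

(** [x ∈ α_i], for an increasing sequence of countable ordinals with union [ω_1].
    Starting from [a0] makes the columns infinite. *)
Definition below (i x : V) : Prop :=
  x ∈ a0 \/ exists u j y, maps c u j /\ j ∈ i /\ maps g u y /\ x ∈ y.

Definition is_column (i X : V) : Prop :=
  forall x, x ∈ X <-> exists l, point l i x /\ below i l.

Definition is_block (l X : V) : Prop := forall x, x ∈ X <-> exists i, point l i x.

Lemma below_bounded i : i ∈ w -> exists b, b ∈ k1 /\ forall x, below i x -> x ∈ b.
Proof.
  intros I.
  destruct (separation (fun y => exists u j, maps c u j /\ j ∈ i /\ maps g u y) k1)
    as [t T]; [definable|].
  destruct (finite_directed (fun y b => is_subset y b) k1 t) as (b & B & H).
  - definable.
  - apply (finite_image (fun j y => exists u, maps c u j /\ maps g u y) i);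
      [definable|apply nat_finite, I|..].
    + intros j y y' _ (u & Hu & Y) (u' & Hu' & Y'). rewrite (Ic _ _ _ Hu' Hu) in Y'.
      apply (proj2 (proj1 Hg) _ _ _ Y Y').
    + intros y Y. apply T in Y as (_ & u & j & Hu & Hj & Y). eauto.
  - eauto.
  - exact ordinal_directed.
  - intros y Y. apply T in Y as [Y _]. exists y. split; auto. intros x X; exact X.
  - destruct (ordinal_max b a0 B A0) as (m & M & S1 & S2 & _).
    exists m. split; auto. intros x [X | (u & j & y & Hu & Hj & Hy & X)]; auto.
    apply S1, (H y); auto. apply T. split; [apply (proj2 (proj2 Hg) _ _ Hy)|eauto].
Qed.

Lemma below_mono i i' x : i' ∈ w -> i ∈ i' -> below i x -> below i' x.
Proof.
  intros I' H [X | (u & j & y & Hu & Hj & Hy & X)]; [left; auto|right].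
  exists u, j, y. repeat split; auto. eapply nat_trans; eauto.
Qed.

Lemma below_cover l : l ∈ k1 -> exists i, i ∈ w /\ below i l.
Proof.
  intro K. destruct (succ_exists l) as [s S].
  (* Cofinality yields an inclusion only, so it is applied to [l + 1] to obtain [l ∈ y]; likewise
     the index is [j + 1] because [below] asks for [j ∈ i]. *)
  destruct (Cof s) as (u & y & Y & H); [eapply omega1_succ; eauto|].
  destruct (proj1 (proj1 (proj2 Hc) u)) as [j J]; [apply (proj1 (proj2 Hg)); eauto|].
  destruct (succ_exists j) as [i I]. exists i.
  split; [apply (omega_succ i j); auto; apply (proj2 (proj2 Hc) _ _ J)|].
  right. exists u, j, y. repeat split; auto; [apply I; auto|apply H, S; auto].
Qed.

(** Countable because the index is fixed and the bases lie in one countable ordinal [b]; infinite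
    because every limit below [a0] contributes a point. *)
Lemma column_equinumerous i X : i ∈ w -> is_column i X -> equinumerous X w.
Proof.
  intros I HX. destruct (below_bounded i I) as (b & B & Hb).
  destruct (proj2 (proj2 Hk1) b B) as (cb & (Fb & Db & Cb) & Ib).
  apply equinumerous_omega.
  - apply (cover_countable (fun m x => exists l, point l i x /\ maps cb l m)).
    + unfold point, limit; definable.
    + intros x Hx. apply HX in Hx as (l & P & _). apply P.
    + intros m M. destruct (separation (fun x => exists l, point l i x /\ maps cb l m) X)
        as [Y HY]; [unfold point, limit; definable|].
      exists Y. split; [|intros x Hx H; apply HY; auto].
      destruct (succ_exists m) as [s S].
      apply (finite_image (fun j x => exists l, point l i x /\ maps cb l j) s).
      * unfold point, limit; definable.
      * apply nat_finite. eapply omega_succ; eauto.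
      * intros j x x' _ (l & P & Hl) (l' & P' & Hl'). rewrite (Ib _ _ _ Hl' Hl) in P'.
        eapply point_unique; eauto.
      * intros x Hx. apply HY in Hx as [_ H]. exists m. split; auto. apply S; auto.
    + intros x Hx. apply HX in Hx as (l & P & H). destruct (proj1 (Db l) (Hb l H)) as [m M].
      exists m. split; eauto.
  - intro FX. destruct (inter_exists L a0) as [d D]. apply (Inf0 d D).
    apply (finite_image (fun x l => point l i x) X); auto.
    + unfold point, limit; definable.
    + intros x l l' _ P P'. eapply point_base; eauto.
    + intros l Hl. apply D in Hl as [Hl Ha]. apply HL in Hl.
      destruct (point_exists l i Hl I) as [x P]. exists x. split; auto.
      apply HX. exists l. split; auto. left; auto.
Qed.

Lemma block_equinumerous l X : limit l -> is_block l X -> equinumerous X w.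
Proof.
  intros Hl HX. apply equinumerous_sym.
  apply (equinumerous_intro (fun i x => point l i x)).
  - unfold point, limit; definable.
  - intros i I. apply point_exists; auto.
  - intros i x x' _ P P'. eapply point_unique; eauto.
  - intros i i' x _ _ P P'. eapply point_index; eauto.
  - intros i x _ P. apply HX. eauto.
  - intros x Hx. apply HX in Hx as [i P]. exists i. split; auto. apply P.
Qed.

(** The block fixes the base of a common point and the column fixes its index. *)
Lemma column_block_inter i l X B x y : is_column i X -> is_block l B ->
  x ∈ X -> x ∈ B -> y ∈ X -> y ∈ B -> x = y.
Proof.
  intros HX HB X1 X2 Y1 Y2.
  apply HX in X1 as (l1 & P1 & _), Y1 as (l2 & P2 & _). apply HB in X2 as [j1 Q1], Y2 as [j2 Q2].
  rewrite (point_base _ _ _ _ _ P1 Q1) in P1. rewrite (point_base _ _ _ _ _ P2 Q2) in P2.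
  exact (point_unique _ _ _ _ P1 P2).
Qed.

Lemma columns_equal i j X Y x : is_column i X -> is_column j Y -> x ∈ X -> x ∈ Y -> X = Y.
Proof.
  intros HX HY Hx Hy. apply HX in Hx as (l & P & _). apply HY in Hy as (l' & P' & _).
  rewrite <- (point_base _ _ _ _ _ P P') in P'.
  rewrite (point_index _ _ _ _ P P') in HX. apply ext. intro z. rewrite (HX z), (HY z). tauto.
Qed.

Lemma blocks_equal l l' X Y x : is_block l X -> is_block l' Y -> x ∈ X -> x ∈ Y -> X = Y.
Proof.
  intros HX HY Hx Hy. apply HX in Hx as [i P]. apply HY in Hy as [j P'].
  rewrite (point_base _ _ _ _ _ P P') in HX. apply ext. intro z. rewrite (HX z), (HY z). tauto.
Qed.

Lemma singular_contradiction : False.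
Proof.
  destruct (zf_powerset V HZF k1) as [pk PK].
  destruct (separation (fun X => (exists i, i ∈ w /\ is_column i X) \/
    (exists l, limit l /\ is_block l X)) pk) as [F HF].
  { unfold is_column, is_block, below, point, limit; definable. }
  assert (Col : forall i, i ∈ w -> exists X, is_column i X /\ X ∈ F).
  { intros i I. destruct (separation (fun x => exists l, point l i x /\ below i l) k1) as [X HX].
    { unfold below, point, limit; definable. }
    exists X. assert (HX' : is_column i X).
    { intro x. rewrite HX. split; [tauto|]. intros (l & P & H). split; [apply P|eauto]. }
    split; auto. apply HF. split; [apply PK|eauto]. intros x Hx. apply HX, Hx. }
  assert (Blo : forall l, limit l -> exists X, is_block l X /\ X ∈ F).
  { intros l Hl. destruct (separation (fun x => exists i, point l i x) k1) as [X HX].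
    { unfold point, limit; definable. }
    exists X. assert (HX' : is_block l X).
    { intro x. rewrite HX. split; [tauto|]. intros (i & P). split; [apply P|eauto]. }
    split; auto. apply HF. split; [apply PK|eauto]. intros x Hx. apply HX, Hx. }
  destruct (M2 F) as (f & Ff & Df & Fin & Dis).
  - intros A HA. apply HF in HA as [HA H]. split; [apply PK, HA|].
    destruct H as [(i & I & H) | (l & Hl & H)].
    + exact (column_equinumerous i A I H).
    + exact (block_equinumerous l A Hl H).
  - intros A B HA HB N d D. apply card_lt_two; auto.
    intros x y Hx Hy. apply D in Hx as [XA XB], Hy as [YA YB].
    apply HF in HA as [_ [(i & I & H) | (l & Hl & H)]];
      apply HF in HB as [_ [(i' & I' & H') | (l' & Hl' & H')]].
    + destruct N. exact (columns_equal i i' A B x H H' XA XB).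
    + exact (column_block_inter i l' A B x y H H' XA XB YA YB).
    + exact (column_block_inter i' l B A x y H' H XB XA YB YA).
    + destruct N. exact (blocks_equal l l' A B x H H' XA XB).
  (* The [i]-th finite set consists of the bases of the points removed from column [i]. *)
  - apply (limits_uncountable L HL).
    apply (cover_countable (fun i l => exists X s x,
      is_column i X /\ maps f X s /\ x ∈ s /\ point l i x)).
    + unfold is_column, below, point, limit; definable.
    + intros l Hl. apply HL, Hl.
    + intros i I. destruct (Col i I) as (X & HX & FX).
      destruct (proj1 (Df X) FX) as [s S].
      destruct (separation (fun l => exists x, x ∈ s /\ point l i x) L) as [Y HY].
      { unfold point, limit; definable. }
      exists Y. split.
      * apply (finite_image (fun x l => point l i x) s).
        -- unfold point, limit; definable.
        -- apply (Fin X s S).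
        -- intros x l l' _ P P'. eapply point_base; eauto.
        -- intros l Hl. apply HY in Hl as [_ H]. exact H.
      * intros l Hl (X' & s' & x & HX' & S' & Hx & P). apply HY. split; auto.
        exists x. split; auto.
        replace X' with X in S' by (apply ext; intro z; rewrite (HX z), (HX' z); tauto).
        rewrite (proj2 Ff _ _ _ S S'). exact Hx.
    + intros l Hl. apply HL in Hl. destruct (Blo l Hl) as (B & HB & FB).
      destruct (proj1 (Df B) FB) as [sB SB].
      destruct (below_cover l (proj1 Hl)) as (i0 & I0 & H0).
      destruct (succ_exists i0) as [s0 S0].
      destruct (separation (fun i => exists x, x ∈ sB /\ point l i x) w) as [E HE].
      { unfold point, limit; definable. }
      assert (FE : finite E).
      { apply (finite_image (fun x i => point l i x) sB).
        - unfold point, limit; definable.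
        - apply (Fin B sB SB).
        - intros x i i' _ P P'. eapply point_index; eauto.
        - intros i Hi. apply HE in Hi as [_ H]. exact H. }
      (* [E'] contains the indices of the points that the block loses and all indices up to [i0].
         For [i] outside it, [l + i] lies in column [i] and survives in the block, so the column
         must have lost it. *)
      destruct (finite_cup E s0) as (E' & FE' & S1 & S2); auto.
      { apply nat_finite. eapply omega_succ; eauto. }
      assert (Q : exists i, i ∈ w /\ i ∉ E').
      { apply NNPP. intro Q. apply omega_infinite. apply (finite_subset E'); auto.
        intros i I. apply NNPP. eauto. }
      destruct Q as (i & I & N). exists i. split; auto.
      destruct (Col i I) as (X & HX & FX). destruct (proj1 (Df X) FX) as [s S].
      destruct (point_exists l i Hl I) as [x P]. exists X, s, x.
      split; [exact HX|split; [exact S|split; [|exact P]]].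
      apply NNPP. intro Ns.
      destruct (diff_exists X s) as [C HC]. destruct (diff_exists B sB) as [D HD].
      apply (Dis X B s sB C D S SB); auto.
      (* Were column and block equal, [l + (i + 1)] would belong to the column, all of whose points
         have index [i]. *)
      * intros <-. destruct (succ_exists i) as [i' I'].
        destruct (point_exists l i' Hl) as [x' P']; [eapply omega_succ; eauto|].
        destruct (proj1 (HX x')) as (l' & P'' & _); [apply HB; eauto|].
        rewrite <- (point_base _ _ _ _ _ P' P'') in P''.
        rewrite (point_index _ _ _ _ P' P'') in I'.
        apply (mem_irrefl i). apply I'. auto.
      * exists x. split; [apply HC|apply HD]; split; auto.
        -- apply HX. exists l. split; auto. apply (below_mono i0 i); auto.
           destruct (nat_trichotomy i0 i I0 I) as [Q | [-> | Q]]; auto;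
             destruct N; apply S2, S0; auto.
        -- apply HB. eauto.
        -- intro Hx. apply N, S1, HE. eauto.
Qed.

End Singular.

(** The identity is cofinal. A cofinal map from a smaller ordinal has a countable domain, which is
    the situation refuted by [singular_contradiction]. *)
Lemma omega1_regular_of_M_ED two : is_numeral 2 two -> M_ED w k1 two ->
  has_cofinality k1 k1.
Proof.
  intros T M. split; [apply Hk1|split].
  - destruct (function_exists (fun x y => x = y) k1) as (g & F & D & H);
      [definable|eauto|congruence|].
    exists g. split; [split; [auto|split; [auto|]]|].
    + intros x y Q. apply H in Q as [Q <-]. exact Q.
    + intros a A. exists a, a. split; [apply H; auto|]. intros x X; exact X.
  - intros d D (g & Hg & Cof).
    destruct (separation limit k1) as [L HL]; [unfold limit; definable|].
    assert (HL' : forall x, x ∈ L <-> limit x).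
    { intro x. rewrite HL. split; [tauto|]. intro Q. split; [apply Q|auto]. }
    destruct (limits_below_infinite L HL') as (a & A & Inf).
    destruct (proj2 (proj2 Hk1) d D) as (c & Hc & Ic).
    eapply (singular_contradiction two T M L HL' d g); eauto.
Qed.

End SetTheory.

Theorem theorem1p10 (V : set_structure) (HZF : ZF V) (omega omega1 : V)
    (Homega : is_omega omega) (Homega1 : is_omega1 omega omega1) :
  (UD omega omega1 ->
     forall n : V, n ∈ omega -> M_ED omega omega1 n) /\
  (forall two : V, is_numeral 2 two ->
     M_ED omega omega1 two -> has_cofinality omega1 omega1).
Proof.
  split.
  - intros [e He] n Hn F HF AD.
    exact (essentially_disjoint_of_denumeration HZF omega Homega omega1 Homega1
      e He n Hn F HF AD).
  - intros two T M.
    exact (omega1_regular_of_M_ED HZF omega Homega omega1 Homega1 two T M).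
Qed.
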